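(* Fix an integer $k\geq 2$ and let $\theta:=(\log 2-1/e)^{-1}=3.074390\ldots$. Define \[ \mathcal{E}(k):=\left\{\left(\frac{kt}{s}\right)^{\frac{s}{kt}} \;:\; s,t\in\mathbb{N},\ 1\leq t\leq \theta\log k,\ \frac{kt}{e}\leq s\leq kte,\ (kt)^{1/t}\in\mathbb{N},\ s^{1/t}\in\mathbb{N},\ \gcd(kt,s)=1\right\}. \] Then for every algebraic number $A\in[e^{-e},e^{1/e}]$ with $\mathrm{ord}(A)=k$ and $A\notin\mathcal{E}(k)$, the number $h(A)$ is transcendental.
   Context: For a real $x\in[e^{-e},e^{1/e}]$, the sequence $x,\ x^x,\ x^{x^x},\ldots$ (each term being $x$ raised to the previous term) converges; its limit is denoted $h(x)$ (the iterated exponential function). It satisfies $h(x)=x^{h(x)}$ and $1/e\leq h(x)\leq e$. For an algebraic number $A$, $\mathrm{ord}(A):=\min\{n\in\mathbb{N}: A^n\in\mathbb{Q}\}$ if such $n$ exists, and $\mathrm{ord}(A)=\infty$ otherwise. $\mathbb{N}$ denotes the positive integers. *)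

(* Defs.v *)
From Stdlib Require Import Reals Lra Lia ZArith Arith List.
Open Scope R_scope.

Fixpoint zpoly_eval (l : list Z) (x : R) : R :=
  match l with
  | nil => 0
  | c :: l' => IZR c + x * zpoly_eval l' x
  end.

Definition is_algebraic (x : R) : Prop :=
  exists l : list Z, (exists c, In c l /\ c <> 0%Z) /\ zpoly_eval l x = 0.

Definition is_transcendental (x : R) : Prop := ~ is_algebraic x.

Definition is_rational (x : R) : Prop :=
  exists p q : Z, q <> 0%Z /\ x = IZR p / IZR q.

Definition ord_eq (A : R) (k : nat) : Prop :=
  (1 <= k)%nat /\ is_rational (A ^ k) /\
  forall n : nat, (1 <= n)%nat -> (n < k)%nat -> ~ is_rational (A ^ n).

Fixpoint tower (x : R) (n : nat) : R :=
  match n with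
  | O => x
  | S n' => Rpower x (tower x n')
  end.

Definition h_is (x L : R) : Prop := Un_cv (tower x) L.

Definition theta : R := / (ln 2 - / exp 1).

Definition in_E (k : nat) (y : R) : Prop :=
  exists s t : nat,
    (1 <= t)%nat /\ (1 <= s)%nat /\
    INR t <= theta * ln (INR k) /\
    INR (k * t) / exp 1 <= INR s /\ INR s <= INR (k * t) * exp 1 /\
    (exists m : nat, (m ^ t)%nat = (k * t)%nat) /\
    (exists n : nat, (n ^ t)%nat = s) /\
    Nat.gcd (k * t) s = 1%nat /\
    y = Rpower (INR (k * t) / INR s) (INR s / INR (k * t)).

(* Main.v *)
Require Import Defs.
From Stdlib Require Import Reals Lra Lia ZArith Classical.
Open Scope R_scope.

(** Suppose [L = h(A)] is algebraic.  From [L = A ^ L] one gets [r ^ L = L ^ k]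
    with [r = A ^ k] rational and [r <> 1], so a case of the Gelfond-Schneider
    theorem forces [L] to be rational.  As only real numbers are involved, this
    case has an elementary proof by interpolation determinants (Schneider,
    Laurent).  Let [L] be irrational, [w = ln r], and consider the determinant
    of the values of the [n^4] functions [x^tau * exp (t w x)] ([tau < n^3],
    [t < n]) at the [n^4] points [s1 + s2 L] ([s1, s2 < n^2]).
    - It is nonzero, since by Rolle's theorem a nonzero exponential polynomial
      has fewer real zeros than it has coefficients.
    - Newton interpolation bounds it by [exp (O(n^7 ln n) - n^8 / 2)].
    - Up to a denominator it is an integer polynomial in [L], so that a
      Liouville inequality bounds it from below by [exp (- O(n^7 ln n))].

    Once [L = a / s] in lowest terms, [A ^ a = L ^ s], and Bezout's identity
    makes [A ^ gcd k a] rational; by minimality [k] divides [a], [a = k t], and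
    comparing [A ^ (k t)] with [(a / s) ^ s] shows that [a] and [s] are [t]-th
    powers.  The bound on [t] then follows from [2 ^ t <= k t]. *)

(* The MathComp notations are confined to this module: they would change the
   meaning of the theorem's statement. *)
Module GelfondSchneider.
From mathcomp Require Import all_boot all_order all_algebra all_fingroup.
From mathcomp Require Import ring lra zify Rstruct.
Set Implicit Arguments.
Unset Strict Implicit.
Unset Printing Implicit Defensive.
Import Order.TTheory GRing.Theory Num.Theory.
Local Open Scope ring_scope.
(* By default arguments of type [R] are parsed in [R_scope]. *)
#[local] Bind Scope ring_scope with R.
#[local] Arguments exp _%_ring_scope.

(** * Norms of polynomials and determinants *)

Section PolyNorm.
Variables (R : numDomainType) (rho : R).
Hypothesis rho_ge0 : 0 <= rho.
Implicit Types p q : {poly R}.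

(** This weighted l1 norm serves twice: with [rho = 1] it measures the height of integer
    polynomials, and with a large [rho] it controls derivatives and values on the interval from
    [- rho] to [rho]. *)
Definition pnorm p := \sum_(i < size p) `|p`_i| * rho ^+ i.

Lemma pnormE K p : (size p <= K)%N -> pnorm p = \sum_(i < K) `|p`_i| * rho ^+ i.
Proof.
move=> sK; rewrite /pnorm (big_ord_widen K (fun i => `|p`_i| * rho ^+ i) sK).
rewrite big_mkcond; apply: eq_bigr => i _.
by case: ltnP => // si; rewrite nth_default // normr0 mul0r.
Qed.

Lemma pnorm_ge0 p : 0 <= pnorm p.
Proof. by apply: sumr_ge0 => i _; rewrite mulr_ge0 // exprn_ge0. Qed.

Lemma pnorm0 : pnorm 0 = 0.
Proof. by rewrite /pnorm size_poly0 big_ord0. Qed.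

Lemma pnormD p q : pnorm (p + q) <= pnorm p + pnorm q.
Proof.
have sp := leq_maxl (size p) (size q); have sq := leq_maxr (size p) (size q).
rewrite (pnormE sp) (pnormE sq) (pnormE (size_polyD p q)) -big_split /=.
apply: ler_sum => i _; rewrite -mulrDl ler_wpM2r ?exprn_ge0 //.
by rewrite coefD ler_normD.
Qed.

Lemma pnorm_sum (I : Type) (r : seq I) (P : pred I) (F : I -> {poly R}) :
  pnorm (\sum_(i <- r | P i) F i) <= \sum_(i <- r | P i) pnorm (F i).
Proof.
elim/big_rec2: _ => [|i y x _ le_xy]; first by rewrite pnorm0.
by apply: le_trans (pnormD _ _) _; rewrite lerD2l.
Qed.

Lemma pnormZ c p : pnorm (c *: p) = `|c| * pnorm p.
Proof.
rewrite (pnormE (size_scale_leq c p)) /pnorm mulr_sumr.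
by apply: eq_bigr => i _; rewrite coefZ normrM mulrA.
Qed.

Lemma pnorm_cons p c : pnorm (p * 'X + c%:P) = pnorm p * rho + `|c|.
Proof.
have s : (size (p * 'X + c%:P)%R <= (size p).+1)%N.
  by rewrite size_MXaddC; case: ifP.
rewrite (pnormE s) big_ord_recl /= coefD coefMX coefC /= add0r mulr1 addrC.
congr (_ + _); rewrite /pnorm mulr_suml; apply: eq_bigr => i _.
by rewrite /bump /= add1n coefD coefMX coefC /= addr0 exprSr mulrA.
Qed.

Lemma pnormC c : pnorm c%:P = `|c|.
Proof. by rewrite -[c%:P]add0r -(mul0r 'X) pnorm_cons pnorm0 mul0r add0r. Qed.

Lemma pnormMX p : pnorm (p * 'X) = pnorm p * rho.
Proof. by rewrite -[p * 'X]addr0 -[0]/(0%:P) pnorm_cons normr0 addr0. Qed.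

Lemma pnormXn n : pnorm 'X^n = rho ^+ n.
Proof.
elim: n => [|n IH]; first by rewrite !expr0 pnormC normr1.
by rewrite !exprSr pnormMX IH.
Qed.

Lemma pnormM p q : pnorm (p * q) <= pnorm p * pnorm q.
Proof.
elim/poly_ind: p => [|p c IH]; first by rewrite mul0r pnorm0 mul0r.
rewrite mulrDl mul_polyC (le_trans (pnormD _ _)) // pnormZ pnorm_cons mulrDl.
by rewrite lerD2r -mulrA -(commr_polyX q) mulrA pnormMX mulrAC ler_wpM2r.
Qed.

Lemma pnorm_exp p n : pnorm (p ^+ n) <= pnorm p ^+ n.
Proof.
elim: n => [|n IH]; first by rewrite !expr0 pnormC normr1.
by rewrite !exprS (le_trans (pnormM _ _)) // ler_wpM2l // pnorm_ge0.
Qed.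

Lemma pnorm_prod_le (I : Type) (r : seq I) (F : I -> {poly R}) (h : R) :
  (forall i, pnorm (F i) <= h) -> pnorm (\prod_(i <- r) F i) <= h ^+ size r.
Proof.
move=> Fh; elim: r => [|i r IH]; first by rewrite big_nil expr0 pnormC normr1.
by rewrite big_cons /= exprS (le_trans (pnormM _ _)) // ler_pM ?pnorm_ge0.
Qed.

Lemma pnorm_horner p x : `|x| <= rho -> `|p.[x]| <= pnorm p.
Proof.
move=> xr; rewrite horner_coef (le_trans (ler_norm_sum _ _ _)) //.
apply: ler_sum => i _; rewrite normrM normrX ler_wpM2l //.
by apply: lerXn2r; rewrite // nnegrE.
Qed.

(* Weighting the coefficients by powers of [rho] makes the derivative a
   contraction once [rho] exceeds the degree. *)
Lemma pnorm_deriv p : (size p)%:R <= rho -> pnorm p^`() <= pnorm p.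
Proof.
move=> sp.
have [/eqP|sp0] := posnP (size p).
  by rewrite size_poly_eq0 => /eqP ->; rewrite deriv0.
have s1 : (size p^`() <= (size p).-1)%N.
  by have := @lt_size_deriv _ p; rewrite -size_poly_gt0 => /(_ sp0); case: (size p) sp0.
rewrite (pnormE s1) /pnorm -(prednK sp0) big_ord_recl /=.
rewrite -[X in X <= _]add0r lerD ?mulr1 //; apply: ler_sum => i _.
rewrite /bump /= add1n coef_deriv -mulr_natr normrM -mulrA ler_wpM2l // exprS.
rewrite ler_wpM2r ?exprn_ge0 // ger0_norm ?ler0n // (le_trans _ sp) //.
by rewrite ler_nat (leq_trans (ltn_ord i)) // leq_pred.
Qed.

Lemma pnorm_det n (A : 'M[{poly R}]_n) (h : R) :
  (forall i j, pnorm (A i j) <= h) -> pnorm (\det A) <= n`!%:R * h ^+ n.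
Proof.
move=> Ah; rewrite /determinant (le_trans (pnorm_sum _ _ _)) //.
apply: (@le_trans _ _ (\sum_(s : 'S_n) h ^+ n)); last first.
  by rewrite sumr_const card_Sn mulr_natl.
apply: ler_sum => s _.
have -> : (-1) ^+ s * \prod_i A i (s i) = ((-1) ^+ s : R) *: \prod_i A i (s i).
  by rewrite -mul_polyC rmorphXn /= rmorphN1.
rewrite pnormZ normr_sign mul1r.
have := @pnorm_prod_le _ (enum 'I_n) (fun i => A i (s i)) h (fun i => Ah _ _).
by rewrite size_enum_ord big_enum.
Qed.

End PolyNorm.

(** The bound varies with the column because the gain is columnwise: one column carries the small
    value [q(b)] in the Liouville inequality, and column [m] gains [1 / m!] in the interpolation
    bound. *)
Lemma norm_det_le (R : numDomainType) n (A : 'M[R]_n) (c : 'I_n -> R) :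
  (forall i j, `|A i j| <= c j) -> `|\det A| <= n`!%:R * \prod_j c j.
Proof.
move=> Ac; rewrite -det_tr /determinant (le_trans (ler_norm_sum _ _ _)) //.
apply: (@le_trans _ _ (\sum_(s : 'S_n) \prod_j c j)); last first.
  by rewrite sumr_const card_Sn mulr_natl.
apply: ler_sum => s _; rewrite normrM normr_sign mul1r normr_prod.
by apply: ler_prod => i _; rewrite normr_ge0 mxE Ac.
Qed.

Lemma norm_mxX_le (R : numDomainType) n (A : 'M[R]_n.+1) (K : R) :
  (forall i j, `|A i j| <= K) -> 1 <= K ->
  forall m i j, `|(A ^+ m) i j| <= (n.+1%:R * K) ^+ m.
Proof.
move=> AK K1; elim=> [|m IH] i j.
  by rewrite expr0 mxE; case: eqP; rewrite ?normr1 ?normr0.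
rewrite exprS mxE (le_trans (ler_norm_sum _ _ _)) //.
apply: (@le_trans _ _ (\sum_(k < n.+1) K * (n.+1%:R * K) ^+ m)).
  by apply: ler_sum => k _; rewrite normrM ler_pM.
by rewrite sumr_const card_ord -[_ *+ n.+1]mulr_natl mulrA -exprS.
Qed.

(** * A Liouville inequality *)

(* The integer matrix [B] of the proof has [v = (1, b, .., b ^ d)] as an
   eigenvector, with eigenvalue [b0 * b]; hence [M] has eigenvector [v] with
   eigenvalue [b0 ^ N * q(b)].  Minimality of the degree of [g] makes
   [\det M] a nonzero integer, and replacing the first column of [M] by [M v]
   exhibits the factor [q(b)] of this determinant. *)
Lemma liouville_min (F : numFieldType) (g : {poly int}) (b : F) (d : nat) :
  size g = d.+2 -> root (map_poly intr g) b ->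
  (forall g' : {poly int}, g' != 0 -> root (map_poly intr g') b ->
     (size g <= size g')%N) ->
  exists C : F, 1 <= C /\
    forall (N : nat) (H : F) (q : {poly int}), (size q <= N.+1)%N -> 1 <= H ->
      (pnorm 1 q)%:~R <= H -> (map_poly intr q).[b] != 0 ->
      1 <= `|(map_poly intr q).[b]| * (C ^+ N.+1 * H) ^+ d.+1.
Proof.
move=> sg rg gmin.
pose b0 : int := lead_coef g.
have b0E : b0 = g`_d.+1 by rewrite /b0 lead_coefE sg.
have g0 : g != 0 by rewrite -size_poly_gt0 sg.
have b0_neq0 : b0 != 0 by rewrite /b0 lead_coef_eq0.
pose v : 'cV[F]_d.+1 := \col_i b ^+ i.
(* The first [d] rows shift [b ^ i] to [b0 * b ^ i.+1]; the last row rewrites [b0 * b ^ d.+1] by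
   means of [g(b) = 0]. *)
pose B : 'M[int]_d.+1 :=
  \matrix_(i, j) if (i < d)%N then b0 *+ (j == i.+1 :> nat) else - g`_j.
pose Bf : 'M[F]_d.+1 := map_mx intr B.
have Bv : Bf *m v = (b0%:~R * b) *: v.
  apply/matrixP => i j; rewrite !mxE; under eq_bigr => k _ do rewrite !mxE.
  case: (ltnP i d) => id.
    rewrite (bigD1 (inord i.+1)) //= inordK // eqxx mulr1n big1 => [|k].
      by rewrite addr0 exprS mulrA.
    move=> ki; case: eqP => [kE|]; last by rewrite mulr0n mul0r.
    by case/eqP: ki; apply: val_inj; rewrite /= kE inordK.
  have -> : i = d :> nat by apply/eqP; rewrite eqn_leq id -ltnS ltn_ord.
  have := rg; rewrite /root horner_coef size_map_inj_poly ?rmorph0 //; last first.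
    exact: intr_inj.
  rewrite sg big_ord_recr /= !coef_map /= -b0E addr_eq0 => /eqP rE.
  rewrite -mulrA -exprS; apply: oppr_inj; rewrite -rE -sumrN.
  by apply: eq_bigr => k _; rewrite coef_map /= rmorphN mulNr opprK.
pose K : int := 1 + \sum_i \sum_j `|B i j|.
have K1 : 1 <= K by rewrite lerDl; do 2!apply: sumr_ge0 => ? _.
have BK i j : `|B i j| <= K.
  rewrite /K (bigD1 i) //= (bigD1 j) //=.
  set s1 := \sum_(_ < _ | _) _; set s2 := \sum_(_ < _ | _) _.
  have s1_ge0 : 0 <= s1 by apply: sumr_ge0.
  have s2_ge0 : 0 <= s2 by apply: sumr_ge0 => ? _; apply: sumr_ge0.
  have le2 (x y z : int) : 0 <= y -> 0 <= z -> x <= 1 + (x + y + z).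
    by move=> y0 z0; rewrite -[x in X in X <= _]add0r -!addrA lerD // lerDl addr_ge0.
  exact: le2.
pose C0 : int := `|b0| + d.+1%:R * K.
have b01 : 1 <= `|b0| by rewrite -gtz0_ge1 normr_gt0.
have dK0 : 0 <= d.+1%:R * K by rewrite mulr_ge0 // (le_trans _ K1).
have C01 : 1 <= C0 by rewrite (le_trans b01) // lerDl.
have C0_ge0 : 0 <= C0 by apply: le_trans C01.
pose V : F := 1 + \sum_i `|v i 0|.
have V1 : 1 <= V by rewrite lerDl sumr_ge0.
have vV i : `|v i 0| <= V.
  by rewrite /V (bigD1 i) //= addrCA lerDl addr_ge0 // sumr_ge0.
have f1 : 1 <= d.+1`!%:R :> F by rewrite ler1n fact_gt0.
have C0F : 1 <= C0%:~R :> F by rewrite -[1]/(1%:~R) ler_int.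
have C0F0 : 0 <= C0%:~R :> F by apply: le_trans C0F.
have C0N N : 1 <= C0%:~R ^+ N :> F by rewrite exprn_ege1.
exists (C0%:~R * (d.+1`!%:R * V)); split; first by rewrite !mulr_ege1.
move=> N H q sq H1 qH q0.
set eta := (map_poly intr q).[b] in q0 *.
(* Homogenizing [q] with powers of [b0] keeps the matrix integral although the eigenvalue of [B] is
   [b0 * b] instead of [b]. *)
pose M : 'M[int]_d.+1 := \sum_(i < N.+1) (q`_i * b0 ^+ (N - i)) *: B ^+ i.
pose Mf : 'M[F]_d.+1 := map_mx intr M.
have Mv : Mf *m v = (b0%:~R ^+ N * eta) *: v.
  have Bfi i : Bf ^+ i *m v = (b0%:~R * b) ^+ i *: v.
    elim: i => [|i IH]; first by rewrite !expr0 mul1mx scale1r.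
    by rewrite exprSr -mulmxA Bv -scalemxAr IH scalerA exprS.
  have BfX i : map_mx intr (B ^+ i) = Bf ^+ i.
    elim: i => [|i IH]; first by rewrite !expr0 map_mx1.
    by rewrite !exprS map_mxM IH.
  rewrite /Mf /M map_mx_sum /= mulmx_suml.
  have -> : eta = \sum_(i < N.+1) (q`_i)%:~R * b ^+ i.
    rewrite /eta (@horner_coef_wide _ N.+1) ?size_map_inj_poly //; last exact: intr_inj.
    by apply: eq_bigr => i _; rewrite coef_map.
  rewrite mulr_sumr scaler_suml; apply: eq_bigr => i _.
  have -> : map_mx intr ((q`_i * b0 ^+ (N - i)) *: B ^+ i)
      = (q`_i * b0 ^+ (N - i))%:~R *: Bf ^+ i :> 'M[F]_d.+1.
    by rewrite map_mxZ BfX.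
  rewrite -scalemxAl Bfi scalerA; congr (_ *: _).
  rewrite intrM rmorphXn /= exprMn.
  rewrite (_ : b0%:~R ^+ N = b0%:~R ^+ (N - i) * b0%:~R ^+ i); last first.
    by rewrite -exprD subnK // -ltnS.
  by ring.
have ME i j : `|Mf i j| <= H * C0%:~R ^+ N.
  rewrite mxE -intr_norm.
  apply: (@le_trans _ _ ((pnorm 1 q * C0 ^+ N)%:~R)); last first.
    by rewrite rmorphM rmorphXn ler_wpM2r // exprn_ge0.
  rewrite ler_int /M summxE (le_trans (ler_norm_sum _ _ _)) //.
  rewrite (pnormE _ sq) mulr_suml; apply: ler_sum => k _.
  rewrite expr1n mulr1 mxE !normrM normrX -mulrA ler_wpM2l //.
  have -> : C0 ^+ N = C0 ^+ (N - k) * C0 ^+ k by rewrite -exprD subnK // -ltnS.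
  rewrite ler_pM ?exprn_ge0 //.
    by apply: lerXn2r; rewrite ?nnegrE // /C0 lerDl.
  rewrite (le_trans (norm_mxX_le BK K1 _ _ _)) //.
  by apply: lerXn2r; rewrite ?nnegrE // /C0 lerDr.
have detM : \det M != 0.
  apply/negP => /det0P[u u0 uM].
  have : map_mx intr u *m (Mf *m v) = 0 by rewrite mulmxA -map_mxM uM map_mx0 mul0mx.
  rewrite Mv -scalemxAr => /eqP; rewrite scaler_eq0 mulf_eq0 expf_eq0 intr_eq0.
  rewrite (negPf b0_neq0) (negPf q0) andbF /= => /eqP/matrixP/(_ 0 0).
  rewrite !mxE; under eq_bigr => k _ do rewrite !mxE.
  (* A left kernel vector of [M] is orthogonal to [v], so its entries are the coefficients of a
     polynomial of degree at most [d] vanishing at [b], against the minimality of [g]. *)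
  move=> uv; pose g' : {poly int} := \poly_(i < d.+1) u 0 (inord i).
  have : (size g <= size g')%N.
    apply: gmin.
      apply: contraNneq u0 => g'0; apply/eqP/matrixP => i j; rewrite ord1 mxE.
      have := coef_poly d.+1 (fun i => u 0 (inord i)) j.
      by rewrite -/g' g'0 coef0 ltn_ord inord_val.
    rewrite /root (@horner_coef_wide _ d.+1); last first.
      by rewrite size_map_inj_poly ?size_poly //; exact: intr_inj.
    apply/eqP; rewrite -[RHS]uv; apply: eq_bigr => k _.
    by rewrite coef_map coef_poly ltn_ord inord_val.
  by rewrite sg leqNgt ltnS size_poly.
(* [U] is the identity with first column replaced by [v]; as [v] starts with 1, multiplying by [U]
   puts [M v] in the first column and preserves the determinant. *)
pose U : 'M[F]_d.+1 := \matrix_(i, j) if j == 0 then v i 0 else (i == j)%:R.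
have detU : \det U = 1.
  rewrite det_trig; last first.
    apply/is_trig_mxP => i j ij; rewrite mxE; case: eqP => [j0|_].
      by rewrite j0 in ij.
    by case: eqP => // ijE; rewrite ijE ltnn in ij.
  by apply: big1 => i _; rewrite !mxE eqxx; case: eqP => // ->; rewrite expr0.
have detMf : 1 <= `|\det Mf|.
  by rewrite det_map_mx -intr_norm -[1]/(1%:~R) ler_int -gtz0_ge1 normr_gt0.
pose E := H * C0%:~R ^+ N.
have E1 : 1 <= E by rewrite mulr_ege1.
have C0i : 0 <= C0%:~R ^+ N :> F by apply: le_trans (C0N N).
pose c (j : 'I_d.+1) : F := if j == 0 then C0%:~R ^+ N * `|eta| * V else E.
have MUc i j : `|(Mf *m U) i j| <= c j.
  rewrite /c; case: eqP => j0.
    have -> : (Mf *m U) i j = (Mf *m v) i 0.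
      by rewrite !mxE; apply: eq_bigr => k _; rewrite [U _ _]mxE j0 eqxx.
    rewrite Mv mxE !normrM ler_pM ?ler_wpM2r ?normr_ge0 ?mulr_ge0 //.
    rewrite normrX -intr_norm.
    by apply: lerXn2r; rewrite ?nnegrE ?ler0z ?ler_int // lerDl.
  rewrite mxE (bigD1 j) //= big1 => [|k kj].
    by rewrite !mxE (introF eqP j0) eqxx mulr1 addr0; have := ME i j; rewrite mxE.
  by rewrite [U _ _]mxE (introF eqP j0) (negPf kj) mulr0.
have := norm_det_le MUc; rewrite det_mulmx detU mulr1 big_ord_recl.
rewrite (eq_bigr (fun=> E)) // prodr_const card_ord {1}/c eqxx => dle.
apply: le_trans detMf _; apply: le_trans dle _.
rewrite [(_ * H) ^+ d.+1]exprS.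
set P := C0%:~R * (d.+1`!%:R * V).
have fV1 : 1 <= d.+1`!%:R * V by rewrite mulr_ege1.
have P0 : C0%:~R <= P by rewrite ler_peMr.
have P1 : 1 <= P by apply: le_trans P0.
have P_ge0 : 0 <= P by apply: le_trans P1.
have H_ge0 : 0 <= H by apply: le_trans H1.
have E_ge0 : 0 <= E by apply: le_trans E1.
have V_ge0 : 0 <= V by apply: le_trans V1.
have PN : C0%:~R ^+ N <= P ^+ N by apply: lerXn2r; rewrite ?nnegrE.
have fV0 : 0 <= d.+1`!%:R * V by apply: le_trans fV1.
have PN1 : C0%:~R ^+ N * (d.+1`!%:R * V) <= P ^+ N.+1 * H.
  rewrite -[X in X <= _]mulr1 ler_pM ?mulr_ge0 // exprSr ler_pM //.
  by rewrite /P ler_peMl.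
have EP : E <= P ^+ N.+1 * H.
  rewrite /E [H * _]mulrC ler_wpM2r // exprSr (le_trans PN) //.
  by rewrite ler_peMr // exprn_ge0.
have -> : d.+1`!%:R * (C0%:~R ^+ N * `|eta| * V * E ^+ d)
    = `|eta| * (C0%:~R ^+ N * (d.+1`!%:R * V) * E ^+ d) by ring.
rewrite ler_wpM2l // ler_pM ?exprn_ge0 ?mulr_ge0 //.
by apply: lerXn2r; rewrite ?nnegrE // (le_trans _ EP).
Qed.

(** Descent on the size of [g] reaches a polynomial of minimal size vanishing at [b]; its size is at
    least 2, since a nonzero constant has no root. *)
Lemma liouville (F : numFieldType) (g : {poly int}) (b : F) :
  g != 0 -> root (map_poly intr g) b ->
  exists (C : F) (D : nat), 1 <= C /\
    forall (N : nat) (H : F) (q : {poly int}), (size q <= N.+1)%N -> 1 <= H ->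
      (pnorm 1 q)%:~R <= H -> (map_poly intr q).[b] != 0 ->
      1 <= `|(map_poly intr q).[b]| * (C ^+ N.+1 * H) ^+ D.
Proof.
have [m] := ubnP (size g); elim: m g => // m IH g sm g0 rg.
have [[g' [g'0 rg' ltg]]|gmin] := classic (exists g' : {poly int},
  [/\ g' != 0, root (map_poly intr g') b & (size g' < size g)%N]).
  by apply: (IH g') => //; apply: leq_trans ltg _.
case sg : (size g) => [|[|d]].
- by move/eqP: sg; rewrite size_poly_eq0 (negPf g0).
- move/eqP/size_poly1P: sg => [c c0 gE]; move: rg.
  by rewrite gE map_polyC rootC intr_eq0 (negPf c0).
have [|C [C1 CP]] := liouville_min sg rg; last by exists C, d.+1.
move=> g' g'0 rg'; rewrite leqNgt; apply/negP => lt; apply: gmin; by exists g'.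
Qed.

(** * Exponential polynomials *)

#[local] Arguments derivable_pt_lim _%_function_scope _%_ring_scope _%_ring_scope.
#[local] Arguments Rmult _%_ring_scope _%_ring_scope.
#[local] Arguments Rplus _%_ring_scope _%_ring_scope.

Lemma Rexp0 : exp 0 = 1.
Proof. exact: expR0. Qed.

Lemma RexpD (x y : R) : exp x * exp y = exp (x + y).
Proof. exact: expRD. Qed.

Definition expoly := seq ({poly R} * R).

(* The list of the [(p_i, a_i)] stands for the sum of the [p_i(x) exp (a_i x)]. *)
Definition epeval (F : expoly) (x : R) : R :=
  \sum_(u <- F) u.1.[x] * exp (u.2 * x).

(* Represents [F' - a F], whose zeros are those of the derivative of
   [exp (- a x) F(x)]. *)
Definition epderiv (a : R) (F : expoly) : expoly :=
  [seq (u.1^`() + (u.2 - a) *: u.1, u.2) | u <- F].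

Lemma derivable_horner (p : {poly R}) x :
  derivable_pt_lim (fun y => p.[y]) x p^`().[x].
Proof.
elim/poly_ind: p => [|p c IH].
  rewrite deriv0 horner0; apply: (derivable_pt_lim_ext (fun=> 0)).
    by move=> y; rewrite horner0.
  exact: derivable_pt_lim_const.
rewrite derivD derivM derivX derivC mulr1 addr0 hornerD hornerM hornerX.
apply: (derivable_pt_lim_ext (fun y => Rplus (Rmult p.[y] y) c)).
  by move=> y; rewrite !hornerE.
rewrite -[_ + _]addr0.
have := derivable_pt_lim_plus _ _ _ _ _
  (derivable_pt_lim_mult _ _ _ _ _ IH (derivable_pt_lim_id x))
  (derivable_pt_lim_const c x).
by rewrite !RmultE !RplusE mulr1.
Qed.

Lemma derivable_exp_lin (a x : R) :
  derivable_pt_lim (fun y => exp (a * y)) x (a * exp (a * x)).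
Proof.
have h := derivable_pt_lim_scal _ a _ _ (derivable_pt_lim_id x).
have := derivable_pt_lim_comp _ _ _ _ _ h (derivable_pt_lim_exp _).
by rewrite Rmult_1_r RmultE mulrC.
Qed.

Lemma derivable_epeval (a : R) F x :
  derivable_pt_lim (fun y => exp (- a * y) * epeval F y) x
    (exp (- a * x) * epeval (epderiv a F) x).
Proof.
elim: F => [|[p b] F IH].
  rewrite /epeval big_nil mulr0; apply: (derivable_pt_lim_ext (fun=> 0)).
    by move=> y; rewrite /epeval big_nil mulr0.
  exact: derivable_pt_lim_const.
apply: (derivable_pt_lim_ext
   (fun y => p.[y] * exp ((b - a) * y) + exp (- a * y) * epeval F y)).
  move=> y; rewrite /epeval big_cons mulrDr /=; congr (_ + _).
  rewrite mulrCA RexpD; congr (_ * exp _). by rewrite mulrBl mulNr addrC.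
have := derivable_pt_lim_plus _ _ _ _ _
  (derivable_pt_lim_mult _ _ _ _ _ (derivable_horner p x) (derivable_exp_lin (b - a) x)) IH.
congr derivable_pt_lim; rewrite /epeval big_cons mulrDr /=; congr (_ + _).
rewrite !RmultE !RplusE hornerD hornerZ.
rewrite (_ : (b - a) * x = - a * x + b * x); last by rewrite mulrBl mulNr addrC.
by rewrite -RexpD; ring.
Qed.

Lemma ep_rolle (a : R) F x y : x < y -> epeval F x = 0 -> epeval F y = 0 ->
  exists z, [/\ x < z, z < y & epeval (epderiv a F) z = 0].
Proof.
move=> xy Fx Fy.
have [|z [Hz [xz zy]]] := MVT_cor2 (fun y => exp (- a * y) * epeval F y)
  (fun y => exp (- a * y) * epeval (epderiv a F) y) x y (elimT RltP xy).
  by move=> c _; apply: derivable_epeval.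
exists z; split; [exact/RltP|exact/RltP|].
move: Hz; rewrite Fx Fy !mulr0 RminusE subr0 RmultE => /esym/eqP.
rewrite !mulf_eq0 subr_eq0 (gt_eqF xy) orbF => /orP[/eqP e0|/eqP //].
by have := exp_pos (- a * z); rewrite e0 => /Rlt_irrefl.
Qed.

(** Rolle is applied between consecutive zeros. The path condition already bounds the new zeros from
    below; the last clause keeps track of an upper bound. *)
Lemma ep_rolle_path (a : R) (F : expoly) (x : R) (s : seq R) : path <%R x s ->
  {in x :: s, forall y, epeval F y = 0} ->
  exists s', [/\ size s' = size s, path <%R x s',
    {in s', forall y, epeval (epderiv a F) y = 0} &
    forall B, all (<= B) (x :: s) -> all (<= B) s'].
Proof.
elim: s x => [|y s IH] x; first by move=> _ _; exists [::].
move=> /= /andP[xy pys] F0.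
have [|s' [ss' ps' F's' sB]] := IH y pys.
  by move=> z zs; apply: F0; rewrite inE zs orbT.
have Fx : epeval F x = 0 by apply: F0; rewrite mem_head.
have Fy : epeval F y = 0 by apply: F0; rewrite !inE eqxx orbT.
have [z [xz zy F'z]] := ep_rolle a xy Fx Fy.
exists (z :: s'); split=> /=.
- by rewrite ss'.
- rewrite xz /=; case: s' ps' {ss' sB F's'} => //= w s' /andP[yw ->].
  by rewrite (lt_trans zy yw).
- by move=> w; rewrite inE => /orP[/eqP ->|/F's'].
- move=> B /and3P[_ yB sB']; rewrite sB /= ?yB ?sB' // andbT.
  exact: le_trans (ltW zy) yB.
Qed.

(** For [a = 0] the operator [epderiv] is the ordinary derivative, and each derivation costs one
    zero. *)
Lemma ep_rolle_iter (B : R) (F : expoly) (s : seq R) m :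
  sorted <%R s -> size s = m.+1 ->
  {in s, forall y, epeval F y = 0} -> all (<= B) s -> all (>= 0) s ->
  exists z, [/\ 0 <= z, z <= B & epeval (iter m (epderiv 0) F) z = 0].
Proof.
elim: m F s => [|m IH] F [//|x s] ps [ss] F0 sB s0.
  exists x; split=> /=; first by case/andP: s0.
    by case/andP: sB.
  by apply: F0; rewrite mem_head.
have [s' [ss' ps' F's' sB']] := ep_rolle_path 0 ps F0.
rewrite iterSr; apply: (IH _ s'); rewrite ?ss' ?sB' //.
  exact: path_sorted ps'.
have x0 : 0 <= x by case/andP: s0.
have := order_path_min lt_trans ps'.
by apply: sub_all => y /ltW; exact: le_trans.
Qed.

(** Multiplying by [exp (- a x)] and differentiating removes one coefficient from the term of
    exponent [a]. The other terms keep their sizes because their exponents differ from [a], and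
    Rolle loses only one zero, so induction on the number of coefficients applies. *)
Lemma ep_zeros (F : expoly) (s : seq R) :
  uniq [seq u.2 | u <- F] -> all (fun u => u.1 != 0) F ->
  sorted <%R s -> {in s, forall y, epeval F y = 0} ->
  (\sum_(u <- F) size u.1 <= size s)%N -> F = [::].
Proof.
have [n] := ubnP (\sum_(u <- F) size u.1)%N.
elim: n F s => // n IH [//|[p a] F] s.
rewrite big_cons /= => ltn /andP[aF uF] /andP[p0 F0] ss s0 les.
have sp0 : (0 < size p)%N by rewrite size_poly_gt0.
case: s ss s0 les => [|x s] ss s0 les.
  by move: les; rewrite /= leqn0 addn_eq0 eqn0Ngt sp0.
have [s' [ss' ps' F's' _]] := ep_rolle_path a ss s0.
pose G := epderiv a F.
have szG : (\sum_(u <- G) size u.1 = \sum_(u <- F) size u.1)%N.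
  rewrite big_map /= big_seq [RHS]big_seq; apply: eq_bigr => -[q b] /= qF.
  have ba : b - a != 0.
    by rewrite subr_eq0; apply: contraNneq aF => <-; apply/mapP; exists (q, b).
  have q0 : q != 0 by have := allP F0 _ qF.
  by rewrite addrC size_polyDl size_scale // lt_size_deriv.
have G2 : [seq u.2 | u <- G] = [seq u.2 | u <- F] by rewrite -map_comp.
have G0 : all (fun u => u.1 != 0) G.
  apply/allP => u /mapP[[q b] qF ->] /=.
  have ba : b - a != 0.
    by rewrite subr_eq0; apply: contraNneq aF => <-; apply/mapP; exists (q, b).
  have q0 : q != 0 by have := allP F0 _ qF.
  by rewrite -size_poly_gt0 addrC size_polyDl size_scale // ?lt_size_deriv // size_poly_gt0.
have evE y : epeval (epderiv a ((p, a) :: F)) y = p^`().[y] * exp (a * y) + epeval G y.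
  by rewrite /epeval big_cons /= subrr scale0r addr0.
(* If [p] is constant its term disappears, and the induction hypothesis empties the rest of the
   list. What remains is [c * exp (a * x)] with [c != 0], which has no zero. *)
have [p'0|p'0] := eqVneq p^`() 0.
  have sG : G = [::].
    apply: (IH G s'); rewrite ?G2 ?szG //.
    - exact: leq_trans (leq_add sp0 (leqnn _)) ltn.
    - exact: path_sorted ps'.
    - by move=> y ys; rewrite -(F's' y ys) evE p'0 horner0 mul0r add0r.
    - by rewrite ss' -ltnS; apply: leq_trans (leq_add sp0 (leqnn _)) les.
  have F_nil : F = [::] by move: sG; rewrite /G; case: (F).
  have sp1 : size p = 1%N.
    apply/eqP; rewrite eqn_leq sp0 andbT leqNgt; apply/negP => sp2.
    have := coef_deriv p (size p).-2; rewrite p'0 coef0.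
    have -> : (size p).-2.+1 = (size p).-1 by lia.
    rewrite -lead_coefE => /esym/eqP.
    rewrite -mulr_natr mulf_eq0 lead_coef_eq0 (negPf p0) pnatr_eq0 /=.
    by case: (size p) sp2 => [|[]].
  have /eqP/size_poly1P[c c0 pE] := sp1.
  have := s0 x (mem_head _ _); rewrite F_nil pE /epeval big_seq1 /= hornerC.
  move/eqP; rewrite mulf_eq0 (negPf c0) /= => /eqP e0.
  by have := exp_pos (a * x); rewrite e0 => /Rlt_irrefl.
have sp' : (size p^`() < size p)%N by rewrite lt_size_deriv.
suff : (p^`(), a) :: G = [::] by [].
apply: (IH _ s') => /=; rewrite ?big_cons ?szG ?G2 ?aF ?p'0 //=.
- by rewrite -ltnS; apply: leq_trans _ ltn; rewrite ltnS ltn_add2r.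
- exact: path_sorted ps'.
- by move=> y ys; rewrite -(F's' y ys) evE /epeval big_cons.
- by rewrite ss' -ltnS; apply: leq_trans _ les; rewrite ltn_add2r.
Qed.

(** * Newton interpolation *)

Section Newton.
Variable x : nat -> R.

Definition newton (m : nat) : {poly R} := \prod_(l < m) ('X - (x l)%:P).

Lemma size_newton m : size (newton m) = m.+1.
Proof. by rewrite /newton size_prod_XsubC [index_enum _]unlock -enumT size_enum_ord. Qed.

Lemma monic_newton m : newton m \is monic.
Proof. exact: monic_prod_XsubC. Qed.

Lemma horner_newton m y : (newton m).[y] = \prod_(l < m) (y - x l).
Proof. by rewrite horner_prod; apply: eq_bigr => l _; rewrite !hornerE. Qed.

Lemma newton_node m j : (j < m)%N -> (newton m).[x j] = 0.
Proof.
by move=> jm; rewrite horner_newton (bigD1 (Ordinal jm)) //= subrr mul0r.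
Qed.

(** The system is triangular: [newton n] vanishes at the earlier nodes but not at [x n], so the new
    coefficient can be solved for at [x n] without disturbing the previous equations. *)
Lemma newton_interpolation (f : R -> R) n :
  {in gtn n &, injective x} ->
  exists c : nat -> R, forall j, (j < n)%N ->
    f (x j) = \sum_(i < n) c i * (newton i).[x j].
Proof.
elim: n => [|n IH] xinj; first by exists (fun=> 0).
have [|c cP] := IH.
  by move=> i j /= ni nj; apply: xinj; rewrite inE ltnS ltnW.
have Nn0 : (newton n).[x n] != 0.
  rewrite horner_newton; apply/prodf_neq0 => l _; rewrite subr_eq0.
  apply/eqP => /xinj; rewrite !inE => /(_ _ _)E.
  by have := ltn_ord l; rewrite -E ?ltnn // ltnS ltnW.
pose cn := (f (x n) - \sum_(i < n) c i * (newton i).[x n]) / (newton n).[x n].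
exists (fun i => if i == n then cn else c i) => j jn.
rewrite big_ord_recr /= eqxx (eq_bigr (fun i : 'I_n => c i * (newton i).[x j])); last first.
  by move=> i _; rewrite ltn_eqF.
move: jn; rewrite ltnS leq_eqVlt => /orP[/eqP ->|jn].
  by rewrite /cn divfK // addrC subrK.
by rewrite (newton_node jn) mulr0 addr0 cP.
Qed.

Lemma derivn_small (p : {poly R}) m : (size p <= m.+1)%N ->
  p^`(m) = (p`_m *+ m`!)%:P.
Proof.
move=> sp; apply/polyP => i; rewrite coef_derivn coefC.
case: i => [|i] /=; first by rewrite addn0 ffactnn.
by rewrite nth_default ?mul0rn // (leq_trans sp) // addnS ltnS leq_addr.
Qed.

Lemma iter_epderiv_cat m F G :
  iter m (epderiv 0) (F ++ G) = iter m (epderiv 0) F ++ iter m (epderiv 0) G.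
Proof. by elim: m => //= m ->; rewrite /epderiv map_cat. Qed.

Lemma iter_epderiv_poly m p : iter m (epderiv 0) [:: (p, 0)] = [:: (p^`(m), 0)].
Proof.
elim: m => //= m ->; by rewrite /epderiv /= subr0 scale0r addr0.
Qed.

(** This is the mean value theorem for divided differences. [F] minus its interpolation polynomial
    vanishes at [m.+1] nodes, so its [m]-th derivative has a zero; the [m]-th derivative of the
    polynomial is the constant [c m * m!], since [newton m] is monic. *)
Lemma newton_coef_mean (F : expoly) (c : nat -> R) (B : R) m :
  {in gtn m.+1 &, injective x} ->
  (forall j, (j < m.+1)%N -> 0 <= x j <= B) ->
  (forall j, (j < m.+1)%N ->
    epeval F (x j) = \sum_(i < m.+1) c i * (newton i).[x j]) ->
  exists z, [/\ 0 <= z, z <= B &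
    epeval (iter m (epderiv 0) F) z = c m * m`!%:R].
Proof.
move=> xinj xB cP.
pose P : {poly R} := \sum_(i < m.+1) c i *: newton i.
pose G : expoly := F ++ [:: (- P, 0)].
have GE y : epeval G y = epeval F y - P.[y].
  by rewrite /epeval big_cat big_seq1 /= mul0r exp_0 mulr1 hornerN.
pose s := sort <=%R [seq x j | j <- iota 0 m.+1].
have sE y : (y \in s) = (y \in [seq x j | j <- iota 0 m.+1]) by rewrite mem_sort.
have [|||||z [z0 zB Gz]] := @ep_rolle_iter B G s m.
- rewrite lt_sorted_uniq_le sort_sorted ?andbT; last exact: le_total.
  rewrite sort_uniq map_inj_in_uniq ?iota_uniq // => i j.
  by rewrite !mem_iota /= add0n => im jm; apply: xinj.
- by rewrite size_sort size_map size_iota.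
- move=> y; rewrite sE => /mapP[j]; rewrite mem_iota add0n => /= jm ->.
  rewrite GE cP // horner_sum -sumrB big1 // => i _.
  by rewrite hornerZ subrr.
- apply/allP => y; rewrite sE => /mapP[j]; rewrite mem_iota add0n => /= jm ->.
  by have /andP[] := xB j jm.
- apply/allP => y; rewrite sE => /mapP[j]; rewrite mem_iota add0n => /= jm ->.
  by have /andP[] := xB j jm.
exists z; split=> //.
have sP : (size (- P)%R <= m.+1)%N.
  rewrite size_polyN (leq_trans (size_sum _ _ _)) //; apply/bigmax_leqP => i _.
  by rewrite (leq_trans (size_scale_leq _ _)) // size_newton.
move: Gz; rewrite /G iter_epderiv_cat iter_epderiv_poly derivn_small //.
rewrite {1}/epeval big_cat big_seq1 /= mul0r exp_0 mulr1 hornerC -/(epeval _ _).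
rewrite coefN /P coef_sum big_ord_recr /= big1 => [|i _]; last first.
  by rewrite coefZ nth_default ?mulr0 // size_newton.
have := monic_newton m; rewrite monicE lead_coefE size_newton /= => /eqP nm.
by rewrite add0r coefZ nm mulr1 mulNrn mulr_natr => /eqP; rewrite subr_eq0 => /eqP.
Qed.

(** The matrix is the product of the Newton coefficients and the values of the Newton basis. The
    second factor is triangular with diagonal entries at most [X ^ m], and the mean value theorem
    bounds column [m] of the first by [B m / m!]. *)
Lemma det_epeval_le L (F : 'I_L -> expoly) (X : R) (B : nat -> R) :
  {in gtn L &, injective x} ->
  (forall j, (j < L)%N -> 0 <= x j <= X) ->
  (forall i m z, (m < L)%N -> 0 <= z <= X ->
     `|epeval (iter m (epderiv 0) (F i)) z| <= B m) ->
  `|\det (\matrix_(i < L, j < L) epeval (F i) (x j))|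
    <= L`!%:R * \prod_(m < L) (B m / m`!%:R * X ^+ m).
Proof.
move=> xinj xX FB.
have [c cP] := fin_all_exists (fun i => newton_interpolation (epeval (F i)) xinj).
pose C : 'M[R]_L := \matrix_(i, m) c i m.
pose N : 'M[R]_L := \matrix_(m, j) (newton m).[x j].
have -> : \matrix_(i < L, j < L) epeval (F i) (x j) = C *m N.
  apply/matrixP => i j; rewrite !mxE cP //.
  by apply: eq_bigr => m _; rewrite !mxE.
rewrite det_mulmx normrM big_split mulrA /=; apply: ler_pM => //; last first.
  rewrite -det_tr det_trig; last first.
    by apply/is_trig_mxP => j m jm; rewrite !mxE newton_node.
  rewrite normr_prod; apply: ler_prod => j _; rewrite normr_ge0 !mxE.
  rewrite horner_newton normr_prod -[X in _ <= _ ^+ X](card_ord j) -prodr_const.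
  apply: ler_prod => l _; rewrite normr_ge0 /=.
  have /andP[xj0 xjX] := xX j (ltn_ord j).
  have /andP[xl0 xlX] := xX l (ltn_trans (ltn_ord l) (ltn_ord j)).
  by rewrite ler_norml; lra.
apply: norm_det_le => i m; rewrite mxE.
have xinj' : {in gtn m.+1 &, injective x}.
  by move=> j k /= jm km; apply: xinj; rewrite inE; apply: leq_trans (ltn_ord m).
have jL j : (j < m.+1)%N -> (j < L)%N by move=> jm; apply: leq_trans (ltn_ord m).
have [||z [z0 zX zE]] := @newton_coef_mean (F i) (c i) X m xinj'.
- by move=> j /jL; exact: xX.
- move=> j jm; rewrite (cP i _ (jL j jm)).
  (* At a node of index at most [m] the Newton polynomials of index beyond [m] vanish, so the sum
     may stop at [m]. *)
  rewrite (big_ord_widen L (fun k => c i k * (newton k).[x j]) (ltn_ord m)).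
  rewrite [RHS]big_mkcond; apply: eq_bigr => k _; case: ltnP => // mk.
  by rewrite newton_node ?mulr0 // (leq_trans jm).
have f0 : 0 < m`!%:R :> R by rewrite ltr0n fact_gt0.
rewrite ler_pdivlMr // -[X in _ * X]ger0_norm ?(ltW f0) // -normrM -zE.
by apply: FB; rewrite ?z0 ?zX.
Qed.

End Newton.

(** * Exponential monomials: nonvanishing and growth *)

Lemma epeval_filter (F : expoly) y :
  epeval [seq u <- F | u.1 != 0] y = epeval F y.
Proof.
rewrite /epeval big_filter [RHS](bigID (fun u => u.1 != 0)) /=.
rewrite [X in _ = _ + X]big1 ?addr0 // => u /negPn/eqP ->.
by rewrite horner0 mul0r.
Qed.

(** A linear relation between the rows is an exponential polynomial with at most [T0 * T1]
    coefficients that vanishes at [L = T0 * T1] distinct nodes, so [ep_zeros] makes it trivial. *)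
Lemma det_expmonomials_neq0 (T0 T1 L : nat) (w : R) (x : nat -> R) :
  (0 < T1)%N -> L = (T0 * T1)%N -> w != 0 -> {in gtn L &, injective x} ->
  \det (\matrix_(i < L, j < L)
     epeval [:: ('X^(i %/ T1), (i %% T1)%:R * w)] (x j)) != 0.
Proof.
case: T1 => // T1 _ LE w0 xinj; apply/negP => /det0P[u u0 uA].
pose t (i : 'I_L) : 'I_T1.+1 := inord (i %% T1.+1).
have tE (i : 'I_L) : t i = (i %% T1.+1)%N :> nat by rewrite inordK // ltn_pmod.
pose P (k : 'I_T1.+1) : {poly R} := \sum_(i | t i == k) u 0 i *: 'X^(i %/ T1.+1).
pose G0 : expoly := [seq (P k, k%:R * w) | k <- enum 'I_T1.+1].
(* [ep_zeros] asks for nonzero polynomials, so the vanishing [P k] are discarded; that [G] is empty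
   then means that all of them vanish. *)
pose G := [seq v <- G0 | v.1 != 0].
pose s := sort <=%R [seq x j | j <- iota 0 L].
have sE y : (y \in s) = (y \in [seq x j | j <- iota 0 L]) by rewrite mem_sort.
have Gnil : G = [::].
  apply: (@ep_zeros G s).
  - rewrite (subseq_uniq (map_subseq _ (filter_subseq _ _))) // -map_comp.
    rewrite map_inj_uniq ?enum_uniq // => k l /= /(mulIf w0) /eqP.
    by rewrite eqr_nat => /eqP /val_inj.
  - exact: filter_all.
  - rewrite lt_sorted_uniq_le sort_sorted ?andbT; last exact: le_total.
    rewrite sort_uniq map_inj_in_uniq ?iota_uniq // => i j.
    by rewrite !mem_iota /= add0n => im jm; apply: xinj.
  - move=> y; rewrite sE => /mapP[j]; rewrite mem_iota add0n => /= jL ->.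
    rewrite epeval_filter /G0 /epeval big_map big_enum /=.
    have /matrixP/(_ 0 (Ordinal jL)) := uA; rewrite !mxE => uj.
    rewrite -[RHS]uj (partition_big t xpredT) //=; apply: eq_bigr => k _.
    rewrite /P horner_sum mulr_suml; apply: eq_bigr => i /eqP tik.
    by rewrite mxE /epeval big_seq1 /= hornerZ hornerXn -tE tik mulrA.
  - rewrite size_sort size_map size_iota big_filter.
    apply: (@leq_trans (\sum_(v <- G0) T0)%N); last first.
      by rewrite big_map big_enum /= sum_nat_const card_ord mulnC LE.
    rewrite big_mkcond big_seq [X in (_ <= X)%N]big_seq.
    apply: leq_sum => v /mapP[k _ ->] /=; case: ifP => // _.
    rewrite (leq_trans (size_sum _ _ _)) //.
    apply/bigmax_leqP => i _; rewrite (leq_trans (size_scale_leq _ _)) //.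
    by rewrite size_polyXn ltn_divLR // -LE.
have P0 k : P k = 0.
  apply/eqP/negPn/negP => Pk0.
  have : (P k, k%:R * w) \in G.
    by rewrite mem_filter Pk0 /=; apply/mapP; exists k; rewrite ?mem_enum.
  by rewrite Gnil.
move/negP: u0; apply; apply/eqP/matrixP => i0 i; rewrite (ord1 i0) mxE.
have := congr1 (fun p : {poly R} => p`_(i %/ T1.+1)) (P0 (t i)).
rewrite coef0 /P coef_sum (bigD1 i) //= coefZ coefXn eqxx mulr1.
rewrite big1 ?addr0 // => l /andP[/eqP tli li].
rewrite coefZ coefXn; case: eqP => [E|]; last by rewrite mulr0.
case/eqP: li; apply: val_inj.
rewrite /= (divn_eq l T1.+1) (divn_eq i T1.+1) -E; congr (_ + _)%N.
by rewrite -!tE tli.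
Qed.

(** Each derivation turns [p] into [p' + c p]. The size stays below [rho], so [p'] has norm at most
    that of [p], and the norm grows by a factor of at most [1 + |c|]. *)
Lemma iter_epderiv_monomial (rho c : R) (p : {poly R}) m :
  0 <= rho -> (size p)%:R <= rho ->
  exists q : {poly R},
    iter m (epderiv 0) [:: (p, c)] = [:: (q, c)] /\
    pnorm rho q <= (1 + `|c|) ^+ m * pnorm rho p.
Proof.
move=> rho0 sp.
suff [q [-> sq nq]] : exists q : {poly R},
    [/\ iter m (epderiv 0) [:: (p, c)] = [:: (q, c)], (size q <= size p)%N &
        pnorm rho q <= (1 + `|c|) ^+ m * pnorm rho p] by exists q.
elim: m => [|m [q [qE sq nq]]]; first by exists p; rewrite expr0 mul1r.
exists (q^`() + c *: q); split.
- by rewrite iterS qE /epderiv /= subr0.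
- rewrite (leq_trans (size_polyD _ _)) // geq_max (leq_trans _ sq) //=.
    by rewrite (leq_trans (size_scale_leq _ _)).
  by case: (eqVneq q 0) => [->|/lt_size_deriv/ltnW //]; rewrite deriv0.
rewrite exprS -mulrA (le_trans (pnormD rho0 _ _)) // pnormZ mulrDl mul1r.
have dq : pnorm rho q^`() <= pnorm rho q.
  by apply: pnorm_deriv => //; rewrite (le_trans _ sp) // ler_nat.
by apply: lerD; [exact: le_trans nq|rewrite ler_wpM2l].
Qed.

Lemma Rexp_gt0 (a : R) : 0 < exp a.
Proof. exact/RltP/exp_pos. Qed.

Lemma Rexp_le (a b : R) : a <= b -> exp a <= exp b.
Proof. by rewrite le_eqVlt => /orP[/eqP ->|/RltP/exp_increasing/RltP/ltW]. Qed.

Lemma epeval_iter_monomial_le (rho c c' X z : R) n m :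
  n.+1%:R <= rho -> `|c| <= c' -> 0 <= z <= X -> X <= rho ->
  `|epeval (iter m (epderiv 0) [:: ('X^n, c)]) z|
    <= (1 + c') ^+ m * rho ^+ n * exp (c' * X).
Proof.
move=> nrho cc' /andP[z0 zX] Xrho.
have rho0 : 0 <= rho by apply: le_trans nrho.
have c'0 : 0 <= c' by apply: le_trans cc'.
have [|q [-> nq]] := @iter_epderiv_monomial rho c 'X^n m rho0.
  by rewrite size_polyXn.
rewrite /epeval big_seq1 /= normrM ler_pM //.
  apply: le_trans (pnorm_horner rho0 _ _) _; first by rewrite ger0_norm // (le_trans zX).
  apply: le_trans nq _; rewrite pnormXn // ler_wpM2r ?exprn_ge0 //.
  by apply: lerXn2r; rewrite ?nnegrE ?addr_ge0 // lerD2l.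
rewrite gtr0_norm ?Rexp_gt0 //; apply: Rexp_le.
apply: le_trans (ler_norm _) _; rewrite normrM (ger0_norm z0).
by rewrite ler_pM.
Qed.

Lemma exp_ge_term (y : R) m : 0 <= y -> y ^+ m / m`!%:R <= exp y.
Proof.
move=> y0; rewrite /exp; case: exist_exp => l /= hl.
have term_ge0 i : Rle 0 (Rmult (Rinv (INR (Factorial.fact i))) (pow y i)).
  by apply/RleP; rewrite RmultE RinvE INRE RpowE factE mulr_ge0 ?invr_ge0 ?exprn_ge0.
have /RleP := sum_incr _ m l hl term_ge0; apply: le_trans.
rewrite sum_f_R0E big_nat_recr //= INRE RpowE factE.
rewrite mulrC RmultE RinvE lerDr; apply: sumr_ge0 => i _; exact/RleP.
Qed.

Lemma factorial_le_exp n : n`!%:R <= n%:R ^+ n :> R.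
Proof.
rewrite -natrX ler_nat fact_prod big_add1 big_mkord -[X in (_ <= _ ^ X)%N](card_ord n).
by rewrite -prod_nat_const; apply: leq_prod => i _.
Qed.

(** * The interpolation determinant *)

Lemma size_prod_poly_le (A : idomainType) (I : Type) (r : seq I) (F : I -> {poly A}) d :
  (forall i, (size (F i) <= d.+1)%N) ->
  (size (\prod_(i <- r) F i)%R <= (size r * d).+1)%N.
Proof.
move=> Fd; elim: r => [|i r IH]; first by rewrite big_nil size_poly1.
rewrite big_cons /= (leq_trans (size_polyMleq _ _)) // mulSn.
by have := leq_add (Fd i) IH; rewrite addSn addnS; case: (_ + _)%N.
Qed.

Lemma size_det_le (A : idomainType) n (M : 'M[{poly A}]_n) d :
  (forall i j, (size (M i j) <= d.+1)%N) -> (size (\det M)%R <= (n * d).+1)%N.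
Proof.
move=> Md; rewrite /determinant (leq_trans (size_sum _ _ _)) //.
apply/bigmax_leqP => s _; rewrite -[(-1) ^+ s]/((-1) ^+ s : {poly A}).
have -> : (-1) ^+ s * \prod_i M i (s i) = ((-1) ^+ s : A) *: \prod_i M i (s i).
  by rewrite -mul_polyC rmorphXn /= rmorphN1.
rewrite (leq_trans (size_scale_leq _ _)) //.
have := size_prod_poly_le (enum 'I_n) (fun i => Md i (s i)).
by rewrite size_enum_ord big_enum.
Qed.

Section InterpolationDeterminant.
Variables (n k p q : nat) (b w : R).
Hypotheses (n_gt0 : (0 < n)%N) (p_gt0 : (0 < p)%N) (q_gt0 : (0 < q)%N).
Hypothesis exp_w : exp w = p%:R / q%:R.
Hypothesis exp_wb : exp (w * b) = b ^+ k.

(** The index [j] encodes the pair [(s1, s2)] by division by [n ^ 2]; likewise the row index [i] of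
    the matrices below encodes [(tau, t)] by division by [n]. *)
Definition node (j : nat) : R := (j %/ n ^ 2)%:R + (j %% n ^ 2)%:R * b.

Definition interp_mx : 'M[R]_(n ^ 4) :=
  \matrix_(i, j) epeval [:: ('X^(i %/ n), (i %% n)%:R * w)] (node j).

(** Since [exp w = p / q] and [exp (w b) = b ^ k], the factor [exp (t w (s1 + s2 b))] equals
    [(p / q) ^ (t s1) * b ^ (k t s2)]. Multiplying by [q ^ (n ^ 3)] clears the denominator, and [b]
    becomes the indeterminate. *)
Definition interp_poly_mx : 'M[{poly int}]_(n ^ 4) := \matrix_(i, j)
  (((j %/ n ^ 2)%:R%:P + (j %% n ^ 2)%:R%:P * 'X) ^+ (i %/ n) *
  (p ^ ((i %% n) * (j %/ n ^ 2)) * q ^ (n ^ 3 - (i %% n) * (j %/ n ^ 2)))%:R%:P *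
  'X^(k * ((i %% n) * (j %% n ^ 2)))).

Let row_tau (i : 'I_(n ^ 4)) : (i %/ n < n ^ 3)%N.
Proof. by rewrite ltn_divLR // -expnSr. Qed.

Let col_s1 (j : 'I_(n ^ 4)) : (j %/ n ^ 2 < n ^ 2)%N.
Proof. by rewrite ltn_divLR ?expn_gt0 ?n_gt0 // -expnD. Qed.

Let col_s2 (j : 'I_(n ^ 4)) : (j %% n ^ 2 < n ^ 2)%N.
Proof. by rewrite ltn_pmod ?expn_gt0 ?n_gt0. Qed.

Let ts_le (i : 'I_(n ^ 4)) s : (s < n ^ 2)%N -> ((i %% n) * s <= n ^ 3)%N.
Proof.
by move=> sn; rewrite (expnS n 2) leq_mul // ltnW // ltn_pmod.
Qed.

Lemma horner_interp_poly i j :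
  (map_poly intr (interp_poly_mx i j)).[b] = q%:R ^+ (n ^ 3) * interp_mx i j.
Proof.
have q0 : q%:R != 0 :> R by rewrite pnatr_eq0 -lt0n.
rewrite !mxE !rmorphM /= !rmorphXn /= rmorphD rmorphM /= !map_polyC /= map_polyX.
rewrite !hornerE /epeval big_seq1 /= hornerXn /node !mulrz_nat -mulnA.
set s1 := (j %/ n ^ 2)%N; set s2 := (j %% n ^ 2)%N; set t := (i %% n)%N.
have -> : exp (t%:R * w * (s1%:R + s2%:R * b))
    = (p%:R / q%:R) ^+ (t * s1) * b ^+ (k * (t * s2)).
  rewrite -exp_w [b ^+ _]exprM -exp_wb !expRX RexpD; congr (exp _).
  rewrite -[w *+ _]mulr_natr -[(w * b) *+ _]mulr_natr !natrM; ring.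
rewrite expr_div_n.
have -> : q%:R ^+ (n ^ 3) = q%:R ^+ (n ^ 3 - t * s1) * q%:R ^+ (t * s1) :> R.
  by rewrite -exprD subnK //; apply: ts_le (col_s1 j).
have qts0 : q%:R ^+ (t * s1) != 0 :> R by rewrite expf_neq0.
by field.
Qed.

Lemma horner_det_interp_poly :
  (map_poly intr (\det interp_poly_mx)).[b]
    = q%:R ^+ (n ^ 7) * \det interp_mx.
Proof.
have -> : q%:R ^+ (n ^ 7) = (q%:R ^+ (n ^ 3)) ^+ (n ^ 4) :> R.
  by rewrite -exprM -expnD.
rewrite -detZ.
have <- : map_mx (horner_eval b \o map_poly intr) interp_poly_mx
    = q%:R ^+ (n ^ 3) *: interp_mx.
  by apply/matrixP => i j; rewrite [LHS]mxE [RHS]mxE -horner_interp_poly.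
by rewrite det_map_mx.
Qed.

(** An entry has degree at most [n ^ 3] from the power of the node plus [k * n ^ 3] from the
    exponential. *)
Lemma size_det_interp_poly :
  (size (\det interp_poly_mx)%R <= (k.+1 * n ^ 7).+1)%N.
Proof.
have -> : (k.+1 * n ^ 7 = n ^ 4 * (k.+1 * n ^ 3))%N by rewrite (expnD n 3 4); lia.
apply: size_det_le => i j; rewrite mxE.
apply: leq_trans (size_polyMleq _ _) _; rewrite size_polyXn addnS /=.
pose lin : {poly int} := (j %/ n ^ 2)%:R%:P + (j %% n ^ 2)%:R%:P * 'X.
have lin_size : (size lin <= 2)%N.
  rewrite /lin addrC mul_polyC (leq_trans (size_polyD _ _)) // geq_max.
  by rewrite (leq_trans (size_scale_leq _ _)) ?size_polyX //= (leq_trans (size_polyC_leq1 _)).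
rewrite -/lin.
have tau_size : (size (lin ^+ (i %/ n))%R <= (n ^ 3).+1)%N.
  apply: leq_trans (size_poly_exp_leq _ _) _; rewrite ltnS.
  apply: leq_trans (ltnW (row_tau i)); rewrite -[X in (_ <= X)%N]mul1n leq_mul2r.
  by apply/orP; right; case: (size _) lin_size => // -[].
have coef_size : (size (lin ^+ (i %/ n) *
    (p ^ ((i %% n) * (j %/ n ^ 2)) * q ^ (n ^ 3 - (i %% n) * (j %/ n ^ 2)))%:R%:P)%R
    <= (n ^ 3).+1)%N.
  set A := _ ^+ (i %/ n) in tau_size *; rewrite mulrC mul_polyC.
  exact: leq_trans (size_scale_leq _ _) tau_size.
apply: leq_trans (leq_add coef_size (leqnn _)) _.
by rewrite addSn ltnS mulSn leq_add2l leq_mul2l ts_le ?orbT ?col_s2.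
Qed.

(** In each entry the power of the node contributes at most [(2 n ^ 2) ^ (n ^ 3)] and the constant
    at most [(p q) ^ (n ^ 3)]. *)
Lemma pnorm_det_interp_poly :
  pnorm 1 (\det interp_poly_mx)
    <= (n ^ 4)`!%:R * (((2 * n ^ 2) * (p * q)) ^ n ^ 7)%:R.
Proof.
have -> : (((2 * n ^ 2) * (p * q)) ^ n ^ 7)%:R
    = ((((2 * n ^ 2) * (p * q)) ^ n ^ 3)%:R) ^+ (n ^ 4) :> int.
  by rewrite -natrX -expnM -expnD.
apply: pnorm_det => // i j; rewrite mxE.
apply: le_trans (pnormM ler01 _ _) _; rewrite pnormXn // expr1n mulr1.
apply: le_trans (pnormM ler01 _ _) _; rewrite pnormC expnMn [X in _ <= X]natrM.
apply: ler_pM; rewrite ?pnorm_ge0 //.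
  apply: le_trans (pnorm_exp ler01 _ _) _.
  rewrite addrC pnorm_cons pnormC mulr1 !ger0_norm ?ler0n // -natrD -natrX ler_nat.
  apply: (@leq_trans ((2 * n ^ 2) ^ (i %/ n))); last first.
    by rewrite leq_pexp2l ?muln_gt0 ?expn_gt0 ?n_gt0 // ltnW.
  case: (i %/ n)%N => // e.
  by rewrite leq_exp2r // mul2n -addnn leq_add // ltnW.
rewrite ger0_norm ?ler0n // ler_nat expnMn leq_mul //.
  by rewrite leq_pexp2l // ts_le // col_s1.
by rewrite leq_pexp2l // leq_subr.
Qed.

End InterpolationDeterminant.

(** * Upper and lower bounds for the interpolation determinant *)

Lemma le_exp_id (x : R) : x <= exp x.
Proof.
have /RleP := exp_ineq1_le x; apply: le_trans.
by rewrite RplusE lerDr.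
Qed.

Lemma expr_le_exp (x a : R) n : 0 <= x -> x <= exp a -> x ^+ n <= exp (n%:R * a).
Proof.
move=> x0 xa; rewrite mulr_natl -expRX.
by apply: lerXn2r; rewrite ?nnegrE // (le_trans x0).
Qed.

(** Two equal nodes with different [s2] would express [b] as a quotient of naturals. *)
Lemma node_inj (b : R) n : 0 < b ->
  ~ (exists u v : nat, (0 < v)%N /\ b = u%:R / v%:R) -> injective (node n b).
Proof.
move=> b0 birr.
have lt_case (s1 s2 s1' s2' : nat) : (s2 < s2')%N ->
    s1%:R + s2%:R * b <> s1'%:R + s2'%:R * b.
  move=> lt2 E; apply: birr; exists (s1 - s1')%N, (s2' - s2)%N.
  rewrite subn_gt0 lt2; split => //.
  have d0 : 0 < (s2' - s2)%:R :> R by rewrite ltr0n subn_gt0.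
  have E' : s1%:R - s1'%:R = (s2' - s2)%:R * b.
    by rewrite natrB ?(ltnW lt2) // mulrBl; lra.
  have le1 : (s1' <= s1)%N.
    by rewrite -(ler_nat R) -subr_ge0 E' mulr_ge0 ?ltW.
  by rewrite natrB // E' mulrAC divff ?mul1r // gt_eqF.
move=> i j; rewrite /node => E.
case: (ltngtP (i %% n ^ 2) (j %% n ^ 2)) => [lt|lt|E2].
- by case: (lt_case _ _ _ _ lt E).
- by case: (lt_case _ _ _ _ lt (esym E)).
rewrite (divn_eq i (n ^ 2)) (divn_eq j (n ^ 2)) E2; congr (_ * _ + _)%N.
apply/eqP; rewrite -(eqr_nat R); apply/eqP.
by apply: (addIr ((j %% n ^ 2)%:R * b)); rewrite -{1}E2.
Qed.

Lemma node_bounds (b : R) n j : 0 < b -> (j < n ^ 4)%N ->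
  0 <= node n b j <= n%:R ^+ 2 * (1 + b).
Proof.
move=> b0 jn.
have n0 : (0 < n)%N by case: n jn.
have h1 : (j %/ n ^ 2)%:R <= n%:R ^+ 2 :> R.
  by rewrite -natrX ler_nat ltnW // ltn_divLR ?expn_gt0 ?n0 // -expnD.
have h2 : (j %% n ^ 2)%:R <= n%:R ^+ 2 :> R.
  by rewrite -natrX ler_nat ltnW // ltn_pmod ?expn_gt0 ?n0.
rewrite /node addr_ge0 ?mulr_ge0 ?(ltW b0) //=.
by rewrite mulrDr mulr1 lerD // ler_wpM2r // ltW.
Qed.

Lemma sum_ord_natr n : \sum_(i < n) i%:R = n%:R * (n%:R - 1) / 2%:R :> R.
Proof.
elim: n => [|n IH]; first by rewrite big_ord0 !mul0r.
by rewrite big_ord_recr /= IH -natr1; field.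
Qed.

Lemma prod_exp n (f : 'I_n -> R) : \prod_i exp (f i) = exp (\sum_i f i).
Proof. by apply/esym/(big_morph exp) => [x y|]; rewrite ?Rexp0 ?RexpD. Qed.

(* Taking [n = m ^ 2] lets [n <= exp (2 m)] replace all estimates of [ln n]. *)
Section Asymptotics.
Variables (m : nat) (b w : R).
Hypotheses (m_gt0 : (0 < m)%N) (b_gt0 : 0 < b).
Let mu : R := m%:R.
Let n := (m ^ 2)%N.

Let mu1 : 1 <= mu. Proof. by rewrite ler1n. Qed.
Let nE : n%:R = mu ^+ 2. Proof. by rewrite /n natrX. Qed.

Let n_exp : n%:R <= exp (2%:R * mu).
Proof.
by rewrite nE; apply: expr_le_exp; rewrite ?le_exp_id // (le_trans _ mu1).
Qed.

Let mu_le i j : (i <= j)%N -> mu ^+ i <= mu ^+ j.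
Proof. by move=> ij; apply: ler_weXn2l. Qed.

Lemma factorial_n4_le : ((n ^ 4)`!)%:R <= exp (8%:R * mu ^+ 15).
Proof.
apply: le_trans (factorial_le_exp _) _.
apply: le_trans (@expr_le_exp _ (8%:R * mu) _ _ _) _ => //.
  rewrite natrX (_ : 8%:R * mu = 4%:R * (2%:R * mu)); last by ring.
  exact: expr_le_exp.
apply: Rexp_le; rewrite natrX nE -exprM mulrCA ler_wpM2l // -exprSr.
exact: mu_le.
Qed.

Let c0 : R := (1 + b) * (1 + `|w|).

(** In terms of [mu], [n ^ 4 = mu ^ 8]. The 14 is 8 from [(n ^ 4)!] plus 6 from the powers of [rho];
    [c0] comes from the exponential factor and [exp 1 * c0] from the derivatives over factorials.
    The negative term is minus the sum of the [i] below [n ^ 4]. *)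
Lemma det_interp_mx_le :
  1 + b <= n%:R -> injective (node n b) ->
  `|\det (interp_mx n b w)| <=
    exp ((14%:R + c0 + exp 1 * c0) * mu ^+ 15 - mu ^+ 8 * (mu ^+ 8 - 1) / 2%:R).
Proof.
move=> bn inj_node.
have mu_ge0 : 0 <= mu by apply: le_trans mu1.
have w0 := normr_ge0 w.
have n_gt0 : (0 < n)%N by rewrite expn_gt0 m_gt0.
pose X : R := n%:R ^+ 2 * (1 + b).
(* This radius exceeds every exponent [tau], as the derivative bound needs, and it dominates [X]
   because [1 + b <= n]. *)
pose rho : R := n%:R ^+ 3.
have X0 : 0 <= X by rewrite mulr_ge0 ?exprn_ge0 // addr_ge0 // ltW.
have Xrho : X <= rho by rewrite /rho exprSr ler_wpM2l // exprn_ge0.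
pose W : R := 1 + n%:R * `|w|.
have W0 : 0 <= W by rewrite addr_ge0 // mulr_ge0.
have rho0 : 0 <= rho by rewrite exprn_ge0.
have rho1 : 1 <= rho by rewrite exprn_ege1 // ler1n.
pose B i : R := W ^+ i * rho ^+ (n ^ 3) * exp (n%:R * `|w| * X).
have := @det_epeval_le (node n b) (n ^ 4)
  (fun i => [:: ('X^(i %/ n), (i %% n)%:R * w)]) X B.
move=> /(_ (in2W inj_node)) /(_ (fun j => @node_bounds b n j b_gt0)) detB.
apply: le_trans (detB _) _.
  move=> i l z _ zX.
  apply: le_trans (@epeval_iter_monomial_le rho _ (n%:R * `|w|) X _ _ _ _ _ zX Xrho) _.
  - by rewrite /rho -natrX ler_nat ltn_divLR // -expnSr.
  - by rewrite normrM ger0_norm // ler_wpM2r // ler_nat ltnW // ltn_pmod.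
  rewrite -/W /B ler_wpM2r ?(ltW (Rexp_gt0 _)) // ler_wpM2l ?exprn_ge0 //.
  by apply: ler_weXn2l => //; rewrite ltnW // ltn_divLR // -expnSr.
have WX : W * X <= c0 * mu ^+ 6.
  have -> : c0 * mu ^+ 6 = (mu ^+ 2 * (1 + `|w|)) * (mu ^+ 4 * (1 + b)).
    by rewrite /c0; ring.
  rewrite /X nE -exprM ler_pM //; first by rewrite mulr_ge0 ?exprn_ge0 // addr_ge0 // ltW.
  by rewrite /W nE mulrDr mulr1 lerD2r exprn_ege1.
have wX : n%:R * `|w| * X <= c0 * mu ^+ 6.
  by apply: le_trans WX; rewrite ler_wpM2r // /W lerDr.
have rho_exp : rho ^+ (n ^ 3) <= exp (6%:R * mu ^+ 7).
  apply: le_trans (@expr_le_exp _ (6%:R * mu) _ _ _) _ => //.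
    rewrite (_ : 6%:R * mu = 3%:R * (2%:R * mu)); last by ring.
    exact: expr_le_exp.
  by apply: Rexp_le; rewrite natrX nE -exprM mulrCA -exprSr.
pose c := 6%:R + c0 + exp 1 * c0.
have c00 : 0 <= c0 by rewrite mulr_ge0 // addr_ge0 // ltW.
(* With [Y = W X], [Y ^ i / i! = (e Y) ^ i / i! * exp (- i) <= exp (e Y - i)]. *)
have term (i : 'I_(n ^ 4)) : B i / i`!%:R * X ^+ i <= exp (c * mu ^+ 7 - i%:R).
  have -> : B i / i`!%:R * X ^+ i =
      rho ^+ (n ^ 3) * exp (n%:R * `|w| * X) * ((exp 1 * (W * X)) ^+ i / i`!%:R) * exp (- i%:R).
    rewrite /B !exprMn.
    have E : exp 1 ^+ i * exp (- i%:R) = 1 :> R.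
      by rewrite expRX RexpD subrr Rexp0.
    rewrite -[LHS]mulr1 -[X in _ * X]E; ring.
  have WX0 : 0 <= W * X by rewrite mulr_ge0.
  have e0 : 0 <= exp 1 :> R by rewrite ltW ?Rexp_gt0.
  have -> : c * mu ^+ 7 - i%:R =
      6%:R * mu ^+ 7 + c0 * mu ^+ 7 + exp 1 * (c0 * mu ^+ 7) - i%:R by rewrite /c; ring.
  rewrite -!RexpD ler_wpM2r ?(ltW (Rexp_gt0 _)) //.
  have c67 : c0 * mu ^+ 6 <= c0 * mu ^+ 7 by rewrite ler_wpM2l // mu_le.
  apply: ler_pM.
  - by rewrite mulr_ge0 ?exprn_ge0 // ltW ?Rexp_gt0.
  - by apply: mulr_ge0; rewrite ?invr_ge0 ?ler0n //; apply: exprn_ge0; apply: mulr_ge0.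
  - apply: ler_pM => //; [by rewrite exprn_ge0|by rewrite ltW ?Rexp_gt0|].
    by apply: Rexp_le; apply: le_trans wX _.
  - apply: le_trans (exp_ge_term _ _) _; first by rewrite mulr_ge0.
    by apply: Rexp_le; rewrite ler_wpM2l // (le_trans WX).
have prod_le : \prod_(i < n ^ 4) (B i / i`!%:R * X ^+ i) <=
    exp (c * mu ^+ 15 - mu ^+ 8 * (mu ^+ 8 - 1) / 2%:R).
  have -> : c * mu ^+ 15 - mu ^+ 8 * (mu ^+ 8 - 1) / 2%:R =
      \sum_(i < n ^ 4) (c * mu ^+ 7 - i%:R).
    rewrite big_split /= sumrN sum_ord_natr sumr_const card_ord -[_ *+ n ^ 4]mulr_natr.
    rewrite natrX nE -exprM. by rewrite -[c * _ * _]mulrA -exprD.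
  rewrite -prod_exp; apply: ler_prod => i _; rewrite term andbT.
  by rewrite mulr_ge0 ?divr_ge0 ?mulr_ge0 ?exprn_ge0 // ltW ?Rexp_gt0.
have -> : (14%:R + c0 + exp 1 * c0) * mu ^+ 15 - mu ^+ 8 * (mu ^+ 8 - 1) / 2%:R =
   8%:R * mu ^+ 15 + (c * mu ^+ 15 - mu ^+ 8 * (mu ^+ 8 - 1) / 2%:R) by rewrite /c; ring.
rewrite -RexpD ler_pM ?factorial_n4_le //.
apply: prodr_ge0 => i _.
by rewrite mulr_ge0 ?divr_ge0 ?mulr_ge0 ?exprn_ge0 // ltW ?Rexp_gt0.
Qed.

(** The Liouville inequality is applied to the integer determinant. In the exponent, [q] pays for
    the denominator [q ^ (n ^ 7)], [C * k.+2] for the power of [C], and [12 + 2 p q] for the height: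
    8 from [(n ^ 4)!], the rest from [(2 n ^ 2 p q) ^ (n ^ 7)]. *)
Lemma det_interp_mx_ge (k p q D : nat) (C : R) :
  (0 < p)%N -> (0 < q)%N -> exp w = p%:R / q%:R -> exp (w * b) = b ^+ k ->
  w != 0 -> injective (node n b) -> 1 <= C ->
  (forall (N : nat) (H : R) (Q : {poly int}), (size Q <= N.+1)%N -> 1 <= H ->
      (pnorm 1 Q)%:~R <= H -> (map_poly intr Q).[b] != 0 ->
      1 <= `|(map_poly intr Q).[b]| * (C ^+ N.+1 * H) ^+ D) ->
  1 <= `|\det (interp_mx n b w)| *
    exp ((q%:R + D%:R * (C * k.+2%:R + (12%:R + 2%:R * (p * q)%:R))) * mu ^+ 15).
Proof.
move=> p0 q0 ew ewb w0 inj_node C1 CP.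
have mu_ge0 : 0 <= mu by apply: le_trans mu1.
have n_gt0 : (0 < n)%N by rewrite expn_gt0 m_gt0.
have q00 : q%:R != 0 :> R by rewrite pnatr_eq0 -lt0n.
pose H : R := (n ^ 4)`!%:R * ((2 * n ^ 2 * (p * q)) ^ n ^ 7)%:R.
have H1 : 1 <= H.
  by rewrite mulr_ege1 // ler1n ?fact_gt0 // !(expn_gt0, muln_gt0) p0 q0 m_gt0.
have det0 : \det (interp_mx n b w) != 0.
  apply: (@det_expmonomials_neq0 (n ^ 3) n (n ^ 4) w (node n b)) => //.
    by rewrite -expnSr.
  by move=> i j _ _; apply: inj_node.
have := CP _ H _ (size_det_interp_poly k n_gt0 p0 q0) H1.
rewrite (horner_det_interp_poly n_gt0 q0 ew ewb).
have nH : (pnorm 1 (\det (interp_poly_mx n k p q)))%:~R <= H.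
  rewrite /H -[(n ^ 4)`!%:R]mulrz_nat -[((_ ^ _)%N%:R) in X in _ <= X]mulrz_nat -rmorphM.
  by rewrite ler_int pnorm_det_interp_poly.
move=> /(_ nH); rewrite mulf_neq0 ?expf_neq0 // => /(_ isT).
move=> h; apply: le_trans h _; rewrite normrM mulrAC.
rewrite [_ * exp _]mulrC ler_wpM2r // mulrDl -RexpD.
have q_le : `|q%:R ^+ (n ^ 7)| <= exp (q%:R * mu ^+ 15).
  rewrite ger0_norm ?exprn_ge0 //.
  apply: le_trans (@expr_le_exp _ q%:R _ _ _) _; rewrite ?le_exp_id //.
  by apply: Rexp_le; rewrite mulrC ler_wpM2l // natrX nE -exprM mu_le.
rewrite ler_pM ?exprn_ge0 ?mulr_ge0 ?exprn_ge0 ?(le_trans _ C1) ?(le_trans _ H1) //.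
rewrite -mulrA; apply: expr_le_exp.
  by rewrite mulr_ge0 ?exprn_ge0 ?(le_trans _ C1) ?(le_trans _ H1).
have C_ge0 : 0 <= C by apply: le_trans C1.
rewrite mulrDl -RexpD ler_pM ?exprn_ge0 ?(le_trans _ H1) //.
  apply: le_trans (expr_le_exp _ _ (le_exp_id _)) _ => //.
  apply: Rexp_le; rewrite mulrC -mulrA ler_wpM2l //.
  rewrite (@le_trans _ _ (k.+2%:R * mu ^+ 14)) //; last by rewrite ler_wpM2l // mu_le.
  have -> : mu ^+ 14 = (n ^ 7)%:R by rewrite natrX nE -exprM.
  rewrite -natrM ler_nat (_ : k.+2 * n ^ 7 = k.+1 * n ^ 7 + n ^ 7)%N; last first.
    by rewrite !mulSn; lia.
  by rewrite -addn1 leq_add2l expn_gt0 n_gt0.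
have -> : (12%:R + 2%:R * (p * q)%:R) * mu ^+ 15
   = 8%:R * mu ^+ 15 + (4%:R + 2%:R * (p * q)%:R) * mu ^+ 15 by ring.
rewrite -RexpD /H ler_pM ?factorial_n4_le // natrX.
have pq : (2 * n ^ 2 * (p * q))%:R <= exp (4%:R * mu + 2%:R * (p * q)%:R).
  rewrite -RexpD (_ : 2 * n ^ 2 * (p * q) = n ^ 2 * (2 * (p * q)))%N; last by lia.
  rewrite natrM ler_pM //; last by rewrite natrM le_exp_id.
  rewrite natrX (_ : 4%:R * mu = 2%:R * (2%:R * mu)); last by ring.
  exact: expr_le_exp.
apply: le_trans (expr_le_exp _ _ pq) _ => //; apply: Rexp_le.
have -> : (n ^ 7)%:R = mu ^+ 14 :> R by rewrite natrX nE -exprM.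
rewrite [mu ^+ 15]exprSr mulrDr mulrDl mulrA.
have := ler_wpM2l (mulr_ge0 (ler0n R 2) (ler0n R (p * q))) (mu_le (leqnSn 14)).
by rewrite exprSr; lra.
Qed.

End Asymptotics.

Theorem rational_exponent (k p q : nat) (b w : R) (g : {poly int}) :
  (0 < p)%N -> (0 < q)%N -> exp w = p%:R / q%:R -> w != 0 ->
  0 < b -> exp (w * b) = b ^+ k -> g != 0 -> root (map_poly intr g) b ->
  exists u v : nat, (0 < v)%N /\ b = u%:R / v%:R.
Proof.
move=> p0 q0 ew w0 b0 ewb g0 rg; apply: NNPP => birr.
have [C [D [C1 CP]]] := liouville g0 rg.
pose c1 : R := 14%:R + (1 + b) * (1 + `|w|) + exp 1 * ((1 + b) * (1 + `|w|)).
pose c2 : R := q%:R + D%:R * (C * k.+2%:R + (12%:R + 2%:R * (p * q)%:R)).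
(* For [m > M] the three summands give [4 (c1 + c2) mu ^ 7 < mu ^ 8], [1 + b <= n] and [mu > 2]. As
   [(mu ^ 8 - 1) / 2 >= mu ^ 8 / 4], the two bounds on the determinant then contradict each
   other. *)
pose M : R := 4%:R * (c1 + c2) + (1 + b) + 2%:R.
pose m := (Num.Def.archi_bound M).
have c10 : 0 <= c1.
  have e0 : 0 <= exp 1 by rewrite ltW ?Rexp_gt0.
  have bw0 : 0 <= (1 + b) * (1 + `|w|) by rewrite mulr_ge0 // addr_ge0 // ltW.
  by apply: addr_ge0; [exact: addr_ge0|exact: mulr_ge0].
have c20 : 0 <= c2.
  have C0 : 0 <= C by apply: le_trans C1.
  apply: addr_ge0 => //; apply: mulr_ge0 => //; apply: addr_ge0.
    exact: mulr_ge0.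
  by apply: addr_ge0 => //; apply: mulr_ge0.
have M0 : 0 <= M by rewrite /M; lra.
have Mm : M < m%:R := archi_boundP M0.
have m2 : 2%:R < m%:R :> R by apply: le_lt_trans Mm; rewrite /M; lra.
have m_gt0 : (0 < m)%N by rewrite -(ltr_nat R); lra.
have inj : injective (node (m ^ 2)%N b) := node_inj b0 birr.
have bn : 1 + b <= (m ^ 2)%N%:R.
  have : 1 + b <= m%:R by apply: ltW; apply: le_lt_trans Mm; rewrite /M; lra.
  by move=> h; rewrite natrX; nra.
have := det_interp_mx_ge m_gt0 b0 p0 q0 ew ewb w0 inj C1 CP.
have := det_interp_mx_le w m_gt0 b0 bn inj.
rewrite -/c1 -/c2; set mu : R := m%:R in Mm m2 *.
set d := `|_| => up lo.
have : 1 <= exp (c1 * mu ^+ 15 - mu ^+ 8 * (mu ^+ 8 - 1) / 2%:R) * exp (c2 * mu ^+ 15).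
  by apply: le_trans lo _; rewrite ler_wpM2r // ltW ?Rexp_gt0.
rewrite RexpD; apply/negP; rewrite -ltNge -[X in _ < X]Rexp0.
apply/RltP/exp_increasing/RltP.
have mu8 : 1 <= mu ^+ 8 by rewrite exprn_ege1 //; lra.
have -> : mu ^+ 15 = mu ^+ 8 * mu ^+ 7 by rewrite -exprD.
have m78 : mu ^+ 8 = mu * mu ^+ 7 by rewrite -exprS.
have m7 : 0 < mu ^+ 7 by apply: exprn_gt0; lra.
have mu8' : 2%:R <= mu ^+ 8.
  have mu7 : 1 <= mu ^+ 7 by rewrite exprn_ege1 //; lra.
  by rewrite m78 -[2%:R]mulr1; apply: ler_pM => //; lra.
have key : (c1 + c2) * mu ^+ 7 < (mu ^+ 8 - 1) / 2%:R.
  have : 4%:R * ((c1 + c2) * mu ^+ 7) < mu ^+ 8.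
    rewrite m78 mulrA ltr_pM2r //; apply: le_lt_trans Mm; rewrite /M; lra.
  by lra.
have := mulr_gt0 (lt_le_trans ltr01 mu8) (_ : 0 < (mu ^+ 8 - 1) / 2%:R - (c1 + c2) * mu ^+ 7).
by rewrite subr_gt0 => /(_ key); lra.
Qed.

(** * Transfer to the standard library *)

Lemma IZR_int (z : BinNums.Z) : exists i : int, IZR z = i%:~R.
Proof.
have nonneg y : BinInt.Z.le 0 y -> exists i : int, IZR y = i%:~R.
  by case/IZN => n ->; exists n%:Z; rewrite -INR_IZR_INZ INRE.
case: (BinInt.Z.le_ge_cases 0 z) => [/nonneg //|z0].
have [|i iE] := nonneg (BinInt.Z.opp z); first by apply/BinInt.Z.opp_nonneg_nonpos.
exists (- i); rewrite rmorphN /= -iE opp_IZR.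
by rewrite RoppE opprK.
Qed.

Lemma zpoly_eval_horner (l : list BinNums.Z) :
  exists g : {poly int}, (forall x, zpoly_eval l x = (map_poly intr g).[x]) /\
    ((exists c, List.In c l /\ c <> BinNums.Z0) -> g != 0).
Proof.
elim: l => [|c l [g [gE g0]]].
  by exists 0; split=> [x|[c []]//]; rewrite /= rmorph0 horner0.
have [i iE] := IZR_int c; exists (g * 'X + i%:P); split=> [x|[d [dl d0]]].
  rewrite /= gE iE rmorphD rmorphM /= map_polyC map_polyX !hornerE.
  by rewrite RplusE RmultE addrC mulrC.
apply/negP; rewrite -size_poly_eq0 size_MXaddC; case: ifP => // /andP[/eqP gz /eqP i0] _.
move: iE; rewrite i0 -[RHS]/(IZR BinNums.Z0) => /eq_IZR c0.
case: dl => [cd|dl]; first by rewrite -cd c0 in d0.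
by have := g0 (ex_intro _ d (conj dl d0)); rewrite gz eqxx.
Qed.

(** The statement uses standard library operations only, for use outside the module; [p <> q]
    ensures that [w = ln (p / q)] is nonzero. *)
Theorem rational_algebraic_exponent (k p q : nat) (b : R) :
  lt 0 p -> lt 0 q -> p <> q -> Rlt 0 b -> is_algebraic b ->
  Rpower (Rdiv (INR p) (INR q)) b = pow b k ->
  exists u v : nat, lt 0 v /\ b = Rdiv (INR u) (INR v).
Proof.
move=> /ssrnat.ltP p0 /ssrnat.ltP q0 pq /RltP b0 [l [l0 lb]] pb.
have [g [gE /(_ l0) g0]] := zpoly_eval_horner l.
pose r : R := p%:R / q%:R.
have r0 : 0 < r by rewrite divr_gt0 // ltr0n.
have rE : r = Rdiv (INR p) (INR q) by rewrite RdivE !INRE.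
have ew : exp (ln r) = r by apply: exp_ln; apply/RltP.
have w0 : ln r != 0.
  apply/eqP => w0; apply: pq; move: ew; rewrite w0 exp_0 /r => /esym/eqP.
  rewrite -[IZR _]/(1 : R) => /eqP /(divr1_eq).
  by move/eqP; rewrite eqr_nat => /eqP.
have [||u [v [v0 bE]]] := @rational_exponent k p q b (ln r) g p0 q0 ew w0 b0 _ g0.
- by move: pb; rewrite -rE /Rpower RpowE RmultE mulrC.
- by rewrite /root -gE lb eqxx.
by exists u, v; split; [exact/ssrnat.ltP|rewrite RdivE !INRE].
Qed.

(** * Perfect powers from coprimality *)

Lemma expnE (a n : nat) : Nat.pow a n = (a ^ n)%N.
Proof. by elim: n => //= n ->; rewrite expnS. Qed.

(** With a Bezout relation [u s = v t + 1], one gets [y * (y ^ v) ^ t = (x ^ u) ^ t], so [y] is the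
    [t]-th power of [x ^ u / y ^ v]. This quotient is an integer because divisibility of [t]-th
    powers descends to their bases. *)
Lemma root_of_power_eq (s t x y : nat) : (0 < x)%N -> (0 < y)%N -> (0 < s)%N ->
  (0 < t)%N -> coprime s t -> (x ^ t = y ^ s)%N -> exists m, (m ^ t)%N = y.
Proof.
move=> x0 y0 s0 t0 cst E; case: (egcdnP t s0) => u v uv _.
have g1 : gcdn s t = 1%N by apply/eqP.
have E2 : (y * (y ^ v) ^ t = (x ^ u) ^ t)%N.
  by rewrite -!expnM -expnS -addn1 -g1 -uv mulnC expnM -E -expnM mulnC expnM.
have d : (y ^ v %| x ^ u)%N.
  by rewrite -(dvdn_pexp2r _ _ t0) -E2 dvdn_mull.
exists (x ^ u %/ y ^ v)%N; have /divnK dE := d.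
apply/eqP; rewrite -(eqn_pmul2r (_ : 0 < (y ^ v) ^ t)%N); last by rewrite !expn_gt0 y0.
by rewrite -expnMn dE E2.
Qed.

Lemma coprime_gcd (a b : nat) : Nat.gcd a b = 1%N -> coprime a b.
Proof.
move=> ab; apply/eqP/Nat.divide_1_r; rewrite -ab.
by apply: Nat.gcd_greatest; apply/dvdnP; rewrite (dvdn_gcdl, dvdn_gcdr).
Qed.

(** The hypothesis equates the reduced fractions [p ^ t / q ^ t] and [a ^ s / s ^ s], so
    [p ^ t = a ^ s] and [q ^ t = s ^ s]. As [t] divides [a], it is coprime to [s], and
    [root_of_power_eq] applies to both. *)
Lemma coprime_power_roots (a s t p q : nat) :
  lt 0 a -> lt 0 s -> lt 0 t -> lt 0 p -> lt 0 q ->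
  Nat.gcd a s = 1%N -> Nat.gcd p q = 1%N -> Nat.divide t a ->
  Nat.mul (Nat.pow p t) (Nat.pow s s) = Nat.mul (Nat.pow a s) (Nat.pow q t) ->
  (exists m, Nat.pow m t = a) /\ (exists n, Nat.pow n t = s).
Proof.
move=> /ssrnat.ltP a0 /ssrnat.ltP s0 /ssrnat.ltP t0 /ssrnat.ltP p0 /ssrnat.ltP q0.
move=> /coprime_gcd cas /coprime_gcd cpq /dvdnP ta; rewrite !expnE !multE => E.
have cst : coprime s t by rewrite coprime_sym (coprime_dvdl ta).
have pa : (p ^ t = a ^ s)%N.
  have c1 : coprime (p ^ t) (q ^ t) by rewrite coprimeXl // coprimeXr.
  have c2 : coprime (a ^ s) (s ^ s) by rewrite coprimeXl // coprimeXr.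
  apply/eqP; rewrite eqn_dvd -(Gauss_dvdl _ c1) -(Gauss_dvdl (p ^ t) c2).
  by rewrite -E dvdn_mulr //= E dvdn_mulr.
have qs : (q ^ t = s ^ s)%N.
  by apply/eqP; rewrite -(eqn_pmul2l (_ : 0 < a ^ s)%N) ?expn_gt0 ?a0 // -E pa.
have [m mE] := root_of_power_eq p0 a0 s0 t0 cst pa.
have [n nE] := root_of_power_eq q0 s0 s0 t0 cst qs.
by split; [exists m|exists n]; rewrite expnE.
Qed.

End GelfondSchneider.

(** * Rational values of the iterated exponential *)

Definition is_pos_ratio (x : R) : Prop :=
  exists p q : nat, (0 < p)%nat /\ (0 < q)%nat /\ Nat.gcd p q = 1%nat /\
    x = INR p / INR q.

Lemma INR_pos (n : nat) : (0 < n)%nat -> 0 < INR n.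
Proof. apply lt_0_INR. Qed.

Lemma pos_ratio_reduce (u v : nat) : (0 < u)%nat -> (0 < v)%nat ->
  is_pos_ratio (INR u / INR v).
Proof.
intros u0 v0.
destruct (Nat.gcd_divide_l u v) as [a Ha].
destruct (Nat.gcd_divide_r u v) as [b Hb].
assert (g0 : (0 < Nat.gcd u v)%nat).
{ destruct (Nat.gcd u v); [rewrite Nat.mul_0_r in Ha|]; lia. }
pose proof (Nat.gcd_div_gcd u v (Nat.gcd u v)) as G.
remember (Nat.gcd u v) as g eqn:Eg; clear Eg.
specialize (G ltac:(lia) eq_refl); subst u v.
rewrite !Nat.div_mul in G by lia.
assert (a0 : (0 < a)%nat) by (destruct a; simpl in *; lia).
assert (b0 : (0 < b)%nat) by (destruct b; simpl in *; lia).
exists a, b; repeat split; try assumption.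
rewrite !mult_INR.
apply INR_pos in a0; apply INR_pos in b0; apply INR_pos in g0.
field; lra.
Qed.

Lemma pos_ratio_mul (x y : R) :
  is_pos_ratio x -> is_pos_ratio y -> is_pos_ratio (x * y).
Proof.
intros [p [q [p0 [q0 [_ ->]]]]] [p' [q' [p'0 [q'0 [_ ->]]]]].
replace (INR p / INR q * (INR p' / INR q')) with (INR (p * p') / INR (q * q')).
- apply pos_ratio_reduce; lia.
- rewrite !mult_INR; apply INR_pos in q0; apply INR_pos in q'0; field; lra.
Qed.

Lemma pos_ratio_inv (x : R) : is_pos_ratio x -> is_pos_ratio (/ x).
Proof.
intros [p [q [p0 [q0 [G ->]]]]].
replace (/ (INR p / INR q)) with (INR q / INR p).
- apply pos_ratio_reduce; assumption.
- apply INR_pos in q0; apply INR_pos in p0; field; lra.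
Qed.

Lemma pos_ratio_pow (x : R) (n : nat) : is_pos_ratio x -> is_pos_ratio (x ^ n).
Proof.
intros Hx; induction n as [|n IH]; simpl.
- replace 1 with (INR 1 / INR 1) by (simpl; field).
  apply pos_ratio_reduce; lia.
- apply pos_ratio_mul; assumption.
Qed.

Lemma pos_ratio_rational (x : R) : is_pos_ratio x -> is_rational x.
Proof.
intros [p [q [p0 [q0 [_ ->]]]]].
exists (Z.of_nat p), (Z.of_nat q); split; [lia|].
now rewrite <- !INR_IZR_INZ.
Qed.

Lemma rational_pos_ratio (x : R) : 0 < x -> is_rational x -> is_pos_ratio x.
Proof.
intros x0 [p [q [q0 ->]]].
assert (q0' : IZR q <> 0) by (apply not_0_IZR; exact q0).
assert (p0 : p <> 0%Z) by (intros ->; unfold Rdiv in x0; rewrite Rmult_0_l in x0; lra).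
replace (IZR p / IZR q) with (INR (Z.abs_nat p) / INR (Z.abs_nat q)).
- apply pos_ratio_reduce; lia.
- rewrite !INR_IZR_INZ, !Zabs2Nat.id_abs, !abs_IZR.
  unfold Rdiv; rewrite <- Rabs_inv, <- Rabs_mult.
  apply Rabs_right; unfold Rdiv in x0; lra.
Qed.

(** By Bezout, [x ^ gcd] is a quotient of a power of [x ^ m] by a power of [x ^ n]. *)
Lemma pos_ratio_pow_gcd (x : R) (m n : nat) : 0 < x -> (0 < m)%nat ->
  is_pos_ratio (x ^ m) -> is_pos_ratio (x ^ n) -> is_pos_ratio (x ^ Nat.gcd m n).
Proof.
intros x0 m0 Hm Hn.
destruct (Nat.gcd_bezout_pos m n m0) as [a [b E]].
replace (x ^ Nat.gcd m n) with ((x ^ m) ^ a * / ((x ^ n) ^ b)).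
- apply pos_ratio_mul; [|apply pos_ratio_inv]; apply pos_ratio_pow; assumption.
- rewrite <- !pow_mult, (Nat.mul_comm m a), E, pow_add, (Nat.mul_comm n b).
  field; apply pow_nonzero; lra.
Qed.

Lemma exp_monotone (x y : R) : x <= y -> exp x <= exp y.
Proof.
intros [H| ->]; [left; apply exp_increasing; exact H|right; reflexivity].
Qed.

Lemma ln_monotone (x y : R) : 0 < x -> x <= y -> ln x <= ln y.
Proof.
intros x0 [H| ->]; [left; apply ln_increasing; assumption|right; reflexivity].
Qed.

(** * Fixed-point equation and bounds for the limit *)

Section IteratedExponential.
Variables A L : R.
Hypothesis A_low : exp (- exp 1) <= A.
Hypothesis A_high : A <= exp (/ exp 1).
Hypothesis A_L : h_is A L.

Lemma base_pos : 0 < A.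
Proof. pose proof (exp_pos (- exp 1)); lra. Qed.

Lemma ln_base_low : - exp 1 <= ln A.
Proof.
rewrite <- (ln_exp (- exp 1)); apply ln_monotone; [apply exp_pos|exact A_low].
Qed.

Lemma ln_base_high : ln A <= / exp 1.
Proof.
rewrite <- (ln_exp (/ exp 1)); apply ln_monotone; [apply base_pos|exact A_high].
Qed.

Lemma h_fixed_point : L = exp (L * ln A).
Proof.
assert (S1 : Un_cv (fun n => tower A (S n)) L).
{ intros eps He; destruct (A_L eps He) as [N HN]; exists N.
  intros n Hn; apply HN; lia. }
assert (S2 : Un_cv (fun n => exp (tower A n * ln A)) (exp (L * ln A))).
{ apply (continuity_seq (fun x => exp (x * ln A)) (tower A) L); [|exact A_L].
  apply derivable_continuous_pt.
  exists (exp (L * ln A) * ln A).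
  apply (derivable_pt_lim_comp (fun x => x * ln A) exp).
  - pose proof (derivable_pt_lim_scal_right id L 1 (ln A) (derivable_pt_lim_id L)) as H.
    rewrite Rmult_1_l in H; exact H.
  - apply derivable_pt_lim_exp. }
exact (UL_sequence _ _ _ S1 S2).
Qed.

Lemma h_pos : 0 < L.
Proof. rewrite h_fixed_point; apply exp_pos. Qed.

(** If [y <= e], then [A ^ y <= exp (y / e) <= e]. *)
Lemma tower_bounds (n : nat) : 0 < tower A n <= exp 1.
Proof.
pose proof (exp_pos 1) as e0.
pose proof (exp_ineq1_le 1) as e2.
induction n as [|n [IH1 IH2]]; simpl.
- split; [exact base_pos|].
  apply Rle_trans with (1 := A_high), exp_monotone.
  apply Rmult_le_reg_r with (exp 1); [exact e0|rewrite Rinv_l; lra].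
- split; [apply exp_pos|].
  apply exp_monotone.
  apply Rle_trans with (tower A n * / exp 1).
  + apply Rmult_le_compat_l; [lra|exact ln_base_high].
  + apply Rmult_le_reg_r with (exp 1); [exact e0|].
    rewrite Rmult_assoc, Rinv_l; lra.
Qed.

Lemma h_le_e : L <= exp 1.
Proof.
apply Rnot_lt_le; intros H.
destruct (A_L (L - exp 1)) as [N HN]; [lra|].
specialize (HN N (le_n N)); destruct (tower_bounds N) as [_ HT].
unfold Rdist in HN; rewrite Rabs_left in HN; lra.
Qed.

(** If [L < 1 / e], then [L ln A >= - e L > -1], and the fixed-point equation gives [L > 1 / e]. *)
Lemma h_ge_inv_e : / exp 1 <= L.
Proof.
apply Rnot_lt_le; intros H.
pose proof (exp_pos 1) as e0; pose proof h_pos as L0.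
assert (H1 : L * exp 1 < 1).
{ apply Rmult_lt_reg_r with (/ exp 1); [apply Rinv_0_lt_compat; exact e0|].
  rewrite Rmult_assoc, Rinv_r; lra. }
assert (H2 : exp (- (1)) < exp (L * ln A)).
{ apply exp_increasing.
  pose proof (Rmult_le_compat_l L _ _ (Rlt_le _ _ L0) ln_base_low); lra. }
rewrite <- h_fixed_point, exp_Ropp in H2; lra.
Qed.

End IteratedExponential.

(** Since [k t >= 2], the base [m] is at least 2, so [t ln 2 <= ln k + ln t]; the bound
    [ln t <= t / e] then yields the constant [theta]. *)
Lemma exponent_le_theta_log (k t m : nat) : (2 <= k)%nat -> (1 <= t)%nat ->
  (m ^ t = k * t)%nat -> INR t <= theta * ln (INR k).
Proof.
intros k2 t1 mt.
assert (m2 : (2 <= m)%nat).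
{ destruct m as [|[|m]]; [|rewrite Nat.pow_1_l in mt; nia|lia].
  rewrite Nat.pow_0_l in mt; nia. }
pose proof (exp_pos 1) as e0.
assert (t0 : 0 < INR t) by (apply INR_pos; lia).
assert (k0 : 0 < INR k) by (apply INR_pos; lia).
assert (d0 : 0 < ln 2 - / exp 1).
{ assert (/ exp 1 < / 2); [|pose proof ln_lt_2; lra].
  apply Rinv_lt_contravar; [|pose proof (exp_ineq1 1); lra].
  lra. }
assert (H : INR t * ln 2 <= ln (INR k) + ln (INR t)).
{ rewrite <- ln_mult, <- mult_INR, <- mt, pow_INR by assumption.
  rewrite <- Rpower_pow by (apply INR_pos; lia).
  unfold Rpower; rewrite ln_exp.
  apply Rmult_le_compat_l; [lra|].
  apply ln_monotone; [lra|]. replace 2 with (INR 2) by reflexivity.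
  apply le_INR; exact m2. }
(* [t <= exp (t / e)] is the inequality [1 + x <= exp x] at [x = t / e - 1]. *)
assert (H' : ln (INR t) <= INR t * / exp 1).
{ rewrite <- (ln_exp (INR t * / exp 1)); apply ln_monotone; [exact t0|].
  replace (INR t * / exp 1) with (1 + (INR t * / exp 1 - 1)) by ring.
  rewrite exp_plus.
  pose proof (exp_ineq1_le (INR t * / exp 1 - 1)) as I.
  apply Rle_trans with (exp 1 * (INR t * / exp 1)).
  - right; field; lra.
  - apply Rmult_le_compat_l; lra. }
unfold theta.
apply Rmult_le_reg_l with (ln 2 - / exp 1); [exact d0|].
rewrite <- Rmult_assoc, Rinv_r; lra.
Qed.

Theorem theorem2p1 (k : nat) (hk : (2 <= k)%nat) (A : R)
  (hAlg : is_algebraic A)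
  (hlo : exp (- exp 1) <= A) (hhi : A <= exp (/ exp 1))
  (hord : ord_eq A k)
  (hnotE : ~ in_E k A) :
  forall L : R, h_is A L -> is_transcendental L.
Proof.
intros L HL Lalg; apply hnotE.
pose proof (base_pos A hlo) as A0.
pose proof (h_fixed_point A L HL) as fixL.
pose proof (h_pos A L HL) as L0.
pose proof (h_le_e A L hlo hhi HL) as Le.
pose proof (h_ge_inv_e A L hlo HL) as Lie.
pose proof (exp_pos 1) as e0.
assert (lnL : ln L = L * ln A) by (rewrite fixL at 1; apply ln_exp).
destruct hord as [_ [Ak Amin]].
assert (Ak' : is_pos_ratio (A ^ k))
  by (apply rational_pos_ratio; [apply pow_lt|]; assumption).
destruct Ak' as [p [q [p0 [q0 [gpq AkE]]]]].
(* If [A ^ k = 1], then [A = 1] is rational, which contradicts the minimality of [k >= 2] at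
   exponent 1. *)
assert (pq : p <> q).
{ intros E; subst q.
  assert (Ak1 : A ^ k = 1) by (rewrite AkE; apply INR_pos in p0; field; lra).
  assert (lnA : INR k * ln A = 0) by (rewrite <- ln_pow, Ak1 by exact A0; apply ln_1).
  assert (A1 : A = 1).
  { apply Rmult_integral in lnA; destruct lnA as [lnA|lnA].
    - apply INR_eq with (m := 0%nat) in lnA; lia.
    - rewrite <- (exp_ln A A0), lnA; apply exp_0. }
  apply (Amin 1%nat); [lia|lia|].
  exists 1%Z, 1%Z; split; [lia|]; rewrite A1; simpl; field. }
destruct (GelfondSchneider.rational_algebraic_exponent (k := k) p0 q0 pq L0 Lalg)
  as [u [v [v0 LE]]].
{ rewrite <- AkE; unfold Rpower; rewrite ln_pow by exact A0.
  rewrite <- (Rpower_pow k L L0); unfold Rpower; rewrite lnL; f_equal; ring. }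
assert (Lrat : is_pos_ratio L).
{ rewrite LE; apply pos_ratio_reduce; [|exact v0].
  destruct u; [|lia]. exfalso; rewrite LE in L0; unfold Rdiv in L0; simpl in L0; lra. }
clear u v v0 LE.
destruct Lrat as [a [s [a0 [s0 [gas LE]]]]].
pose proof (INR_pos a a0) as a0'; pose proof (INR_pos s s0) as s0'.
(* Multiply [ln L = L ln A] by [s] and use [s L = a]. *)
assert (AaE : A ^ a = L ^ s).
{ rewrite <- !Rpower_pow by assumption; unfold Rpower; f_equal.
  rewrite lnL, LE; field; lra. }
assert (Aa : is_pos_ratio (A ^ a)).
{ rewrite AaE; apply pos_ratio_pow; exists a, s; auto. }
assert (Ag : is_pos_ratio (A ^ Nat.gcd k a)).
{ apply pos_ratio_pow_gcd; [exact A0|lia| |exact Aa]. exists p, q; auto. }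
assert (gk : Nat.gcd k a = k).
{ pose proof (Nat.gcd_divide_l k a) as D.
  apply Nat.divide_pos_le in D; [|lia].
  destruct (Nat.eq_dec (Nat.gcd k a) k) as [E|E]; [exact E|exfalso].
  apply (Amin (Nat.gcd k a)); [|lia|apply pos_ratio_rational; exact Ag].
  assert (Nat.gcd k a <> 0%nat); [|lia].
  intros E0; apply Nat.gcd_eq_0_l in E0; lia. }
assert (ka : Nat.divide k a) by (rewrite <- gk; apply Nat.gcd_divide_r).
destruct ka as [t Ht].
assert (t0 : (0 < t)%nat) by (destruct t; simpl in Ht; lia).
destruct (GelfondSchneider.coprime_power_roots a0 s0 t0 p0 q0 gas gpq)
  as [[m mt] [n nt]].
{ exists k; lia. }
{ apply INR_eq; rewrite !mult_INR, !pow_INR.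
  (* Both sides equal [A ^ (k t) = A ^ a = L ^ s]. *)
  assert (E : (INR p / INR q) ^ t = (INR a / INR s) ^ s).
  { rewrite <- AkE, <- LE, <- AaE, <- pow_mult; f_equal; lia. }
  unfold Rdiv in E; rewrite !Rpow_mult_distr, !pow_inv in E.
  pose proof (INR_pos q q0) as q0'.
  assert (Hq : 0 < INR q ^ t) by (apply pow_lt; exact q0').
  assert (Hs : 0 < INR s ^ s) by (apply pow_lt; exact s0').
  apply (f_equal (fun x => x * (INR q ^ t * INR s ^ s))) in E.
  replace (INR p ^ t * / INR q ^ t * (INR q ^ t * INR s ^ s))
    with (INR p ^ t * INR s ^ s) in E by (field; lra).
  rewrite E; field; lra. }
assert (aE : (k * t)%nat = a) by lia.
exists s, t; rewrite aE.
split; [lia|]; split; [lia|]; split.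
{ apply exponent_le_theta_log with m; lia. }
assert (aLs : INR a = L * INR s) by (rewrite LE; field; lra).
(* The range of [s] comes from [1 / e <= L <= e] with [k t = L s], and the formula for [A] is
   [A = L ^ (1 / L)]. *)
split; [|split; [|split; [|split; [|split]]]].
- apply Rmult_le_reg_r with (exp 1); [exact e0|].
  unfold Rdiv; rewrite Rmult_assoc, Rinv_l, Rmult_1_r, aLs, Rmult_comm by lra.
  apply Rmult_le_compat_l; lra.
- rewrite aLs.
  apply Rle_trans with (/ exp 1 * INR s * exp 1); [right; field; lra|].
  apply Rmult_le_compat_r; [lra|]; apply Rmult_le_compat_r; lra.
- exists m; exact mt.
- exists n; exact nt.
- exact gas.
- unfold Rpower; rewrite <- LE, lnL, <- (exp_ln A A0) at 1; f_equal.
  rewrite LE; field; lra.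
Qed.
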